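(* Let $A$ be a finite dimensional commutative unital local $K$-algebra with a fixed augmentation $\epsilon$, let $\lambda$ be a deformation of a dialgebra $D$ with base $A$, and let $0\to K\xrightarrow{i}B\xrightarrow{p}A\to0$ be an extension of $A$ corresponding to a cohomology class $f\in H^2_{Harr}(A;K)$. Then $\lambda$ can be extended to a deformation of $D$ with base $B$ (that is, there is a deformation $\mu$ of $D$ with base $B$ such that $p_*\mu=\lambda$) if and only if $\mathbb O_\lambda(f)=0$ in $HY^3(D,D)$, where $\mathbb O_\lambda$ is the obstruction map defined in the context.
   Context: $K$ is a field of characteristic zero; tensor products are over $K$ unless indicated. Dialgebra: a $K$-vector space $D$ with two $K$-bilinear products $\dashv,\vdash$ such that for all $x,y,z$: $x\dashv(y\dashv z)=(x\dashv y)\dashv z=x\dashv(y\vdash z)$; $(x\vdash y)\dashv z=x\vdash(y\dashv z)$; $(x\dashv y)\vdash z=x\vdash(y\vdash z)=(x\vdash y)\vdash z$. Trees: $Y_n$ is the set of planar binary rooted trees with $n$ trivalent vertices and $n+1$ leaves labelled $0,\dots,n$ from left to right; $Y_0=\{|\}$, and $|$ is denoted $[0]$; $[1]$ is the unique element of $Y_1$. The grafting $y_1\vee y_2$ of a $p$-tree and a $q$-tree joins their roots to a new root; it is denoted $[y_1\; p{+}q{+}1\; y_2]$ with zeros deleted. Thus $Y_2=\{[12]=[1]\vee|,\ [21]=|\vee[1]\}$ and $Y_3=\{[123]=[12]\vee|,\ [213]=[21]\vee|,\ [131]=[1]\vee[1],\ [312]=|\vee[12],\ [321]=|\vee[21]\}$.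 The face map $d_i:Y_n\to Y_{n-1}$ deletes the $i$-th leaf. Cohomology: $CY^n(D,D)=\mathrm{Hom}_K(K[Y_n]\otimes D^{\otimes n},D)$, with coboundary $\delta=\sum_{i=0}^{n+1}(-1)^i\delta^i$, where for $y\in Y_{n+1}$: $(\delta^0f)(y;a_1,\dots,a_{n+1})=a_1\circ_0^y f(d_0y;a_2,\dots,a_{n+1})$; $(\delta^if)(y;a_1,\dots,a_{n+1})=f(d_iy;a_1,\dots,a_i\circ_i^ya_{i+1},\dots,a_{n+1})$ for $1\le i\le n$; $(\delta^{n+1}f)(y;a_1,\dots,a_{n+1})=f(d_{n+1}y;a_1,\dots,a_n)\circ_{n+1}^ya_{n+1}$. Here $\circ_0^y=\dashv$ if $y=|\vee y_1$ for some $y_1$, and $\vdash$ otherwise; for $1\le i\le n$, $\circ_i^y=\dashv$ if the $i$-th leaf is oriented like $\backslash$ and $\vdash$ if it is oriented like $/$; $\circ_{n+1}^y=\vdash$ if $y=y_1\vee|$ for some $y_1$, and $\dashv$ otherwise. $HY^n(D,D)$ is the resulting cohomology. Deformations: let $A$ be a commutative unital $K$-algebra with augmentation $\epsilon:A\to K$, $\epsilon(1)=1$. A deformation $\lambda$ of $D$ with base $A$ is a dialgebra structure on $A\otimes D$ with $A$-bilinear products $\dashv_\lambda,\vdash_\lambda$ such that $\epsilon\otimes\mathrm{id}:A\otimes D\to D$ is a dialgebra morphism. For a unital homomorphism $\phi:A\to A'$ with $\epsilon'\circ\phi=\epsilon$, the push-out $\phi_*\lambda$ is the deformation with base $A'$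 on $A'\otimes D=A'\otimes_A(A\otimes D)$ given by $(a_1'\otimes_A l_1)*_{\phi_*\lambda}(a_2'\otimes_A l_2)=a_1'a_2'\otimes_A(l_1*_\lambda l_2)$, $*\in\{\dashv,\vdash\}$. Extensions: $K$ is an $A$-module via $\epsilon$. $H^2_{Harr}(A;K)$ is the second Harrison cohomology; its elements are in bijection with isomorphism classes of extensions $0\to K\xrightarrow{i}B\xrightarrow{p}A\to0$ of commutative algebras with $b\,i(k)=i(\epsilon(p(b))k)$. Then $B$ is local and unital, with augmentation $\widehat\epsilon=\epsilon\circ p$. Obstruction map: put $I=i\otimes\mathrm{id}:D\to B\otimes D$, $P=p\otimes\mathrm{id}:B\otimes D\to A\otimes D$, $E=\widehat\epsilon\otimes\mathrm{id}:B\otimes D\to D$. Choose $B$-bilinear operations $\{\,,\}_\dashv,\{\,,\}_\vdash$ on $B\otimes D$ such that, for $*\in\{\dashv,\vdash\}$, $P\{l_1,l_2\}_*=P(l_1)*_\lambda P(l_2)$ for $l_1,l_2\in B\otimes D$, and $\{I(l),l_1\}_*=I[l*E(l_1)]$ for $l\in D$, $l_1\in B\otimes D$. Define $\phi([321];l_1,l_2,l_3)=\{l_1,\{l_2,l_3\}_\dashv\}_\dashv-\{\{l_1,l_2\}_\dashv,l_3\}_\dashv$, $\phi([312];l_1,l_2,l_3)=\{l_1,\{l_2,l_3\}_\vdash\}_\dashv-\{\{l_1,l_2\}_\dashv,l_3\}_\dashv$, $\phi([131];l_1,l_2,l_3)=\{l_1,\{l_2,l_3\}_\dashv\}_\vdash-\{\{l_1,l_2\}_\vdash,l_3\}_\dashv$,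 $\phi([213];l_1,l_2,l_3)=\{l_1,\{l_2,l_3\}_\vdash\}_\vdash-\{\{l_1,l_2\}_\dashv,l_3\}_\vdash$, $\phi([123];l_1,l_2,l_3)=\{l_1,\{l_2,l_3\}_\vdash\}_\vdash-\{\{l_1,l_2\}_\vdash,l_3\}_\vdash$. These take values in $\ker P=I(D)\cong D$ and vanish when some $l_j\in\ker E$, so they induce $\overline\phi:K[Y_3]\otimes((B\otimes D)/\ker E)^{\otimes3}=K[Y_3]\otimes D^{\otimes3}\to\ker P=D$, i.e. $\overline\phi\in CY^3(D,D)$. It is a cocycle whose class depends only on $\lambda$ and $f$; $\mathbb O_\lambda:H^2_{Harr}(A;K)\to HY^3(D,D)$ is defined by $\mathbb O_\lambda(f)=[\overline\phi]$. *)

(* Defs.v *)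
From HB Require Import structures.
From mathcomp Require Import all_boot all_order all_algebra.
From mathcomp Require Import generic_quotient ring_quotient.
From mathcomp Require Import boolp classical_sets functions.
From mathcomp Require Import zify ring.

Set Implicit Arguments.
Unset Strict Implicit.
Unset Printing Implicit Defensive.

Import GRing.Theory.
Local Open Scope ring_scope.
Local Open Scope quotient_scope.

Definition bilin (K : fieldType) (U V W : lmodType K) (b : U -> V -> W) : Prop :=
  (forall u, linear (b u)) /\ (forall v, linear (b^~ v)).

Section LinearFun.
Variables (K : fieldType) (U V : lmodType K) (f : U -> V).
Hypothesis f_lin : linear f.

Lemma linf0 : f 0 = 0.
Proof. by have := f_lin (-1) 0 0; rewrite scaler0 addr0 scaleN1r addNr. Qed.

Lemma linfD x y : f (x + y) = f x + f y.
Proof. by have := f_lin 1 x y; rewrite !scale1r. Qed.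

Lemma linfZ k x : f (k *: x) = k *: f x.
Proof. by have := f_lin k x 0; rewrite linf0 !addr0. Qed.

End LinearFun.

(* The tensor product U (x) V: formal sums of pairs, modulo the congruence  *)
(* generated by commutativity and bilinearity.  Its universal property is   *)
(* given by tpure_bilin, tlift_pure, tlift_linear and tensor_ext.           *)

Section Tensor.
Variables (K : fieldType) (U V : lmodType K).

Inductive tens_eq : seq (U * V) -> seq (U * V) -> Prop :=
| te_refl s : tens_eq s s
| te_sym s t : tens_eq s t -> tens_eq t s
| te_trans s t r : tens_eq s t -> tens_eq t r -> tens_eq s r
| te_cat s s' t t' : tens_eq s s' -> tens_eq t t' -> tens_eq (s ++ t) (s' ++ t')
| te_comm s t : tens_eq (s ++ t) (t ++ s)
| te_0 v : tens_eq [:: (0, v)] [::]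
| te_addl u u' v : tens_eq [:: (u + u', v)] [:: (u, v); (u', v)]
| te_addr u v v' : tens_eq [:: (u, v + v')] [:: (u, v); (u, v')]
| te_scale k u v : tens_eq [:: (k *: u, v)] [:: (u, k *: v)].

Definition tens_eqb (s t : seq (U * V)) : bool := `[< tens_eq s t >].

Lemma tens_eqb_refl : reflexive tens_eqb.
Proof. by move=> s; apply/asboolP; exact: te_refl. Qed.

Lemma tens_eqb_sym : symmetric tens_eqb.
Proof.
by move=> s t; apply/asboolP/asboolP; exact: te_sym.
Qed.

Lemma tens_eqb_trans : transitive tens_eqb.
Proof.
by move=> s t r /asboolP st /asboolP tr; apply/asboolP; exact: te_trans st tr.
Qed.

Canonical tens_equiv := EquivRel tens_eqb tens_eqb_refl tens_eqb_sym tens_eqb_trans.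

Definition tensor := {eq_quot tens_eqb}.
HB.instance Definition _ := Choice.on tensor.
HB.instance Definition _ : EqQuotient _ tens_eqb tensor := EqQuotient.on tensor.

Definition tcl (s : seq (U * V)) : tensor := \pi_tensor s.

Lemma tclP s t : tcl s = tcl t <-> tens_eq s t.
Proof.
split=> [e|e]; last by apply/eqmodP/asboolP.
by have /eqmodP/asboolP := e.
Qed.

Lemma tcl_repr x : tcl (repr x) = x.
Proof. exact: reprK. Qed.

Definition tadd (x y : tensor) : tensor := tcl (repr x ++ repr y).
Definition tscale (k : K) (x : tensor) : tensor :=
  tcl [seq (k *: p.1, p.2) | p <- repr x].

Lemma tens_eq_scale k s t : tens_eq s t ->
  tens_eq [seq (k *: p.1, p.2) | p <- s] [seq (k *: p.1, p.2) | p <- t].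
Proof.
elim=> //=.
- by move=> *; exact: te_refl.
- by move=> *; exact: te_sym.
- by move=> s0 t0 r _ h _ h'; exact: te_trans h h'.
- by move=> *; rewrite !map_cat; exact: te_cat.
- by move=> *; rewrite !map_cat; exact: te_comm.
- by move=> v; rewrite scaler0; exact: te_0.
- by move=> u u' v; rewrite scalerDr; exact: te_addl.
- by move=> u v v'; exact: te_addr.
- by move=> c u v; rewrite scalerA mulrC -scalerA; exact: te_scale.
Qed.

Lemma tadd_cl s t : tadd (tcl s) (tcl t) = tcl (s ++ t).
Proof. by apply/tclP; apply: te_cat; apply/tclP; rewrite tcl_repr. Qed.

Lemma tscale_cl k s : tscale k (tcl s) = tcl [seq (k *: p.1, p.2) | p <- s].
Proof. by apply/tclP/tens_eq_scale/tclP; rewrite tcl_repr. Qed.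

Lemma taddA : associative tadd.
Proof.
move=> x y z; rewrite -[x]tcl_repr -[y]tcl_repr -[z]tcl_repr.
by rewrite !tadd_cl catA.
Qed.

Lemma taddC : commutative tadd.
Proof. by move=> x y; apply/tclP; exact: te_comm. Qed.

Lemma tadd0 : left_id (tcl [::]) tadd.
Proof. by move=> x; rewrite -[x in LHS]tcl_repr tadd_cl tcl_repr. Qed.

Lemma tscaleDl x k l : tscale (k + l) x = tadd (tscale k x) (tscale l x).
Proof.
rewrite -[x]tcl_repr !tscale_cl tadd_cl; apply/tclP.
elim: (repr x) => [|[u v] s ih] /=; first exact: te_refl.
rewrite scalerDl; set skl := map _ s in ih *.
set sk := map _ s in ih *; set sl := map _ s in ih *.
apply: te_trans (te_cat (te_addl (k *: u) (l *: u) v) ih) _.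
apply: (te_cat (te_refl [:: (k *: u, v)])) => /=.
rewrite -cat1s -[(l *: u, v) :: sl]cat1s !catA.
by apply: te_cat; [exact: te_comm | exact: te_refl].
Qed.

Lemma tscale0 x : tscale 0 x = tcl [::].
Proof.
rewrite -[x]tcl_repr tscale_cl; apply/tclP.
elim: (repr x) => [|[u v] s ih] /=; first exact: te_refl.
by rewrite scale0r -cat1s -[[::]]cats0; exact: te_cat (te_0 _) ih.
Qed.

Lemma tscale1 x : tscale 1 x = x.
Proof.
rewrite -[x]tcl_repr tscale_cl; congr tcl.
by elim: (repr x) => [|[u v] s ih] //=; rewrite ih scale1r.
Qed.

Lemma tscaleA k l x : tscale k (tscale l x) = tscale (k * l) x.
Proof.
rewrite -[x]tcl_repr !tscale_cl -map_comp; congr tcl.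
by apply: eq_map => p /=; rewrite scalerA.
Qed.

Lemma tscaleDr k x y : tscale k (tadd x y) = tadd (tscale k x) (tscale k y).
Proof.
by rewrite -[x]tcl_repr -[y]tcl_repr !(tscale_cl, tadd_cl) map_cat.
Qed.

Lemma taddN : left_inverse (tcl [::]) (tscale (-1)) tadd.
Proof. by move=> x; rewrite -[x in X in tadd _ X]tscale1 -tscaleDl addNr tscale0. Qed.

HB.instance Definition _ :=
  GRing.isZmodule.Build tensor taddA taddC tadd0 taddN.

HB.instance Definition _ := GRing.Zmodule_isLmodule.Build K tensor
  tscaleA tscale1 tscaleDr (fun x k l => tscaleDl x k l).

Definition tpure (u : U) (v : V) : tensor := tcl [:: (u, v)].

Lemma tpure_bilin : bilin tpure.
Proof.
split=> [u k v v'|v k u u'].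
- transitivity (tadd (tscale k (tpure u v)) (tpure u v')); last by [].
  rewrite tscale_cl tadd_cl /=; apply/tclP; apply: te_trans (te_addr _ _ _) _.
  by rewrite -cat1s -[X in tens_eq _ X]cat1s;
    apply: te_cat; [exact/te_sym/te_scale | exact: te_refl].
- transitivity (tadd (tscale k (tpure u v)) (tpure u' v)); last by [].
  by rewrite tscale_cl tadd_cl /=; apply/tclP; exact: te_addl.
Qed.

Lemma tensor_ind (P : tensor -> Prop) : P 0 ->
  (forall x y, P x -> P y -> P (x + y)) -> (forall u v, P (tpure u v)) ->
  forall x, P x.
Proof.
move=> P0 PD Pp x; rewrite -[x]tcl_repr.
elim: (repr x) => [|[u v] s ih] //.
have -> : tcl ((u, v) :: s) = tpure u v + tcl s by exact/esym/tadd_cl.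
by exact: PD.
Qed.

(* The linear map induced by b; it is meaningful only when b is bilinear.   *)
Definition tlift (W : lmodType K) (b : U -> V -> W) (x : tensor) : W :=
  \sum_(p <- repr x) b p.1 p.2.

Section Lift.
Variables (W : lmodType K) (b : U -> V -> W).
Hypothesis b_bilin : bilin b.

Lemma tens_eq_sum s t : tens_eq s t ->
  \sum_(p <- s) b p.1 p.2 = \sum_(p <- t) b p.1 p.2.
Proof.
elim=> //.
- by move=> s0 t0 r _ -> _ ->.
- by move=> s0 s' t0 t' _ h _ h'; rewrite !big_cat /= h h'.
- by move=> s0 t0; rewrite !big_cat; exact: addrC.
- by move=> v; rewrite big_seq1 big_nil (linf0 (b_bilin.2 v)).
- by move=> u u' v; rewrite !big_cons big_nil !addr0 (linfD (b_bilin.2 v)).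
- by move=> u v v'; rewrite !big_cons big_nil !addr0 (linfD (b_bilin.1 u)).
- by move=> k u v; rewrite !big_seq1 (linfZ (b_bilin.2 v)) (linfZ (b_bilin.1 u)).
Qed.

Lemma tlift_cl s : tlift b (tcl s) = \sum_(p <- s) b p.1 p.2.
Proof. by apply: tens_eq_sum; apply/tclP; rewrite tcl_repr. Qed.

Lemma tlift_pure u v : tlift b (tpure u v) = b u v.
Proof. by rewrite tlift_cl big_seq1. Qed.

Lemma tlift_linear : linear (tlift b).
Proof.
move=> k x y; transitivity (tlift b (tadd (tscale k x) y)); first by [].
rewrite -[x]tcl_repr -[y]tcl_repr !(tscale_cl, tadd_cl, tlift_cl).
rewrite big_cat big_map scaler_sumr; congr (_ + _); apply: eq_bigr => p _ /=.
by rewrite (linfZ (b_bilin.2 p.2)).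
Qed.

End Lift.

Lemma tensor_ext (W : lmodType K) (f g : tensor -> W) : linear f -> linear g ->
  (forall u v, f (tpure u v) = g (tpure u v)) -> f =1 g.
Proof.
move=> lf lg fg; elim/tensor_ind => [|x y hx hy|//].
- by rewrite !linf0.
- by rewrite !linfD // hx hy.
Qed.

End Tensor.

Arguments tpure {K U V}.
Arguments tlift {K U V W}.

Notation "U '*t' V" := (tensor U V) (at level 40, left associativity).
Notation "u '#t' v" := (tpure u v) (at level 40, left associativity).

(* dashv is the product written \dashv and vdash the one written \vdash     *)
Inductive dash := dashv | vdash.

Definition dialgebra_axioms (V : Type) (m : dash -> V -> V -> V) : Prop :=
  forall x y z,
  [/\ m dashv x (m dashv y z) = m dashv (m dashv x y) z,
      m dashv (m dashv x y) z = m dashv x (m vdash y z),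
      m dashv (m vdash x y) z = m vdash x (m dashv y z),
      m vdash (m dashv x y) z = m vdash x (m vdash y z) &
      m vdash x (m vdash y z) = m vdash (m vdash x y) z].

Record dialgebra (K : fieldType) (V : lmodType K) := Dialgebra {
  dprod :> dash -> V -> V -> V;
  dprod_bilin : forall s, bilin (dprod s);
  dprodP : dialgebra_axioms dprod }.

Section BaseChange.
Variables (K : fieldType) (D : lmodType K).

(* phi (x) id *)
Definition tmap (A A' : comAlgType K) (phi : A -> A') : A *t D -> A' *t D :=
  tlift (fun a d => phi a #t d).

(* eps (x) id, with K (x) D identified with D *)
Definition taug (A : comAlgType K) (eps : A -> K) : A *t D -> D :=
  tlift (fun a d => eps a *: d).

Definition tact (A : comAlgType K) (a : A) : A *t D -> A *t D :=
  tmap (fun a' => a * a').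

Definition abilin (A : comAlgType K) (m : A *t D -> A *t D -> A *t D) : Prop :=
  (forall a x x' y, m (tact a x + x') y = tact a (m x y) + m x' y) /\
  (forall a x y y', m x (tact a y + y') = tact a (m x y) + m x y').

Lemma tmap_bilin (A A' : comAlgType K) (phi : A -> A') : linear phi ->
  bilin (fun a d => phi a #t d : A' *t D).
Proof.
move=> lphi; split=> [u|v k u u']; first exact: (tpure_bilin A' D).1.
by rewrite lphi; apply: (tpure_bilin A' D).2.
Qed.

Lemma tmap_linear (A A' : comAlgType K) (phi : A -> A') : linear phi ->
  linear (tmap phi).
Proof. by move=> lphi; apply/tlift_linear/tmap_bilin. Qed.

Lemma tmap_pure (A A' : comAlgType K) (phi : A -> A') a d : linear phi ->
  tmap phi (a #t d) = phi a #t d.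
Proof. by move=> lphi; rewrite [LHS]tlift_pure //; exact: tmap_bilin. Qed.

Lemma taug_bilin (A : comAlgType K) (eps : A -> K) : scalar eps ->
  bilin (fun a (d : D) => eps a *: d).
Proof.
move=> leps; split=> [u k d d'|v k u u'].
  by rewrite scalerDr !scalerA mulrC.
by rewrite leps scalerDl scalerA.
Qed.

Lemma taug_linear (A : comAlgType K) (eps : A -> K) : scalar eps ->
  linear (taug eps).
Proof. by move=> leps; apply/tlift_linear/taug_bilin. Qed.

Lemma taug_pure (A : comAlgType K) (eps : A -> K) a d : scalar eps ->
  taug eps (a #t d) = eps a *: d.
Proof. by move=> leps; rewrite [LHS]tlift_pure //; exact: taug_bilin. Qed.

Lemma mull_linear (A : comAlgType K) (a : A) : linear (fun a' => a * a').
Proof. by move=> k x y; rewrite mulrDr scalerAr. Qed.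

Lemma tact_linear (A : comAlgType K) (a : A) : linear (tact a).
Proof. exact/tmap_linear/mull_linear. Qed.

Lemma tact_pure (A : comAlgType K) (a b : A) d :
  tact a (b #t d) = (a * b) #t d.
Proof. exact/tmap_pure/mull_linear. Qed.

Lemma tpureDl (A : lmodType K) (a b : A) (d : D) :
  (a + b) #t d = a #t d + b #t d.
Proof. exact: (linfD ((tpure_bilin A D).2 d)). Qed.

Lemma tact1 (A : comAlgType K) (x : A *t D) : tact 1 x = x.
Proof.
elim/tensor_ind: x => [|x y hx hy|b d].
- exact/linf0/tact_linear.
- by rewrite (linfD (tact_linear _)) hx hy.
- by rewrite tact_pure mul1r.
Qed.

Lemma tactA (A : comAlgType K) (a b : A) (x : A *t D) :
  tact a (tact b x) = tact (a * b) x.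
Proof.
elim/tensor_ind: x => [|x y hx hy|c d].
- by rewrite !(linf0 (tact_linear _)).
- by rewrite !(linfD (tact_linear _)) hx hy.
- by rewrite !tact_pure mulrA.
Qed.

Lemma tactD (A : comAlgType K) (a b : A) (x : A *t D) :
  tact (a + b) x = tact a x + tact b x.
Proof.
elim/tensor_ind: x => [|x y hx hy|c d].
- by rewrite !(linf0 (tact_linear _)) addr0.
- by rewrite !(linfD (tact_linear _)) hx hy addrACA.
- by rewrite !tact_pure mulrDl tpureDl.
Qed.

Lemma tactZ (A : comAlgType K) (k : K) (x : A *t D) : tact k%:A x = k *: x.
Proof.
elim/tensor_ind: x => [|x y hx hy|c d].
- by rewrite (linf0 (tact_linear _)) scaler0.
- by rewrite (linfD (tact_linear _)) hx hy scalerDr.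
- by rewrite tact_pure -scalerAl mul1r; exact: (linfZ ((tpure_bilin A D).2 d)).
Qed.

Lemma abilin_bilin (A : comAlgType K) (m : A *t D -> A *t D -> A *t D) :
  abilin m -> bilin m.
Proof.
by move=> [ml mr]; split=> [x k y y'|y k x x'];
  rewrite -!tactZ; [exact: mr | exact: ml].
Qed.

Lemma tmap_act (A A' : comAlgType K) (phi : {lrmorphism A -> A'}) a x :
  tmap phi (tact a x) = tact (phi a) (tmap phi x).
Proof.
have lphi : linear phi by exact: linearP.
elim/tensor_ind: x => [|x y hx hy|b d].
- by rewrite !(linf0 (tact_linear _), linf0 (tmap_linear lphi)).
- by rewrite !(linfD (tact_linear _), linfD (tmap_linear lphi)) hx hy.
- by rewrite !(tact_pure, tmap_pure _ _ lphi) rmorphM.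
Qed.

End BaseChange.

Section Deformation.
Variables (K : fieldType) (D : lmodType K) (dD : dialgebra D).

Record deformation (A : comAlgType K) (eps : {lrmorphism A -> K^o}) :=
  Deformation {
    defm :> dialgebra (A *t D);
    defm_abilin : forall s, abilin (defm s);
    defm_aug : forall s x y,
      taug eps (defm s x y) = dD s (taug eps x) (taug eps y) }.

Section Pushout.
Variables (A A' : comAlgType K).
Variables (eps : {lrmorphism A -> K^o}) (eps' : {lrmorphism A' -> K^o}).
Variables (phi : {lrmorphism A -> A'}) (phi_eps : forall a, eps' (phi a) = eps a).
Variable lam : deformation eps.

(* With A' (x)_A (A (x) D) identified with A' (x) D, the element            *)
(* a' (x)_A l is tact a' (tmap phi l); pushout_prodE is then the usual      *)
(* formula for the product of the push-out.                                 *)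
Definition pushout_prod (s : dash) (x y : A' *t D) : A' *t D :=
  tlift (fun a1 d1 =>
    tlift (fun a2 d2 =>
      tact (a1 * a2) (tmap phi (lam s (1 #t d1) (1 #t d2)))) y) x.

Let lphi : linear phi := fun k x y => linearP phi k x y.
Let llam s x := (dprod_bilin lam s).1 x.
Let rlam s y := (dprod_bilin lam s).2 y.

Let inner_bilin s a1 d1 : bilin (fun a2 d2 =>
  tact (a1 * a2) (tmap phi (lam s (1 #t d1) (1 #t d2)))).
Proof.
split=> [a k d d'|d k a a'].
- rewrite ((tpure_bilin A D).1) (llam s) (tmap_linear lphi).
  exact: tact_linear.
- by rewrite mulrDr tactD -!tactZ tactA mulrCA -scalerAl mul1r -scalerAr.
Qed.

Let outer_bilin s y : bilin (fun a1 d1 =>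
  tlift (fun a2 d2 =>
    tact (a1 * a2) (tmap phi (lam s (1 #t d1) (1 #t d2)))) y).
Proof.
split=> [a1 k d d'|d1 k a a'];
  elim/tensor_ind: y => [|x y hx hy|a2 d2].
- by rewrite !(linf0 (tlift_linear (inner_bilin _ _ _))) addr0 scaler0.
- rewrite !(linfD (tlift_linear (inner_bilin _ _ _))) hx hy scalerDr.
  exact: addrACA.
- rewrite !(tlift_pure (inner_bilin _ _ _)) ((tpure_bilin A D).1) (rlam s).
  by rewrite (tmap_linear lphi) tact_linear.
- by rewrite !(linf0 (tlift_linear (inner_bilin _ _ _))) addr0 scaler0.
- rewrite !(linfD (tlift_linear (inner_bilin _ _ _))) hx hy scalerDr.
  exact: addrACA.
- rewrite !(tlift_pure (inner_bilin _ _ _)).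
  by rewrite mulrDl tactD -scalerAl -!tactZ tactA -scalerAl mul1r.
Qed.

Lemma pushout_prod_bilin s : bilin (pushout_prod s).
Proof.
split=> [x|y]; last exact: tlift_linear (outer_bilin s y).
move=> k y y'; rewrite /pushout_prod; elim/tensor_ind: x => [|x x' hx hx'|a d].
- by rewrite !(linf0 (tlift_linear (outer_bilin _ _))) addr0 scaler0.
- rewrite !(linfD (tlift_linear (outer_bilin _ _))) hx hx' scalerDr.
  exact: addrACA.
- rewrite !(tlift_pure (outer_bilin _ _)); exact: tlift_linear.
Qed.

Lemma pushout_prod_pure s a1 d1 a2 d2 :
  pushout_prod s (a1 #t d1) (a2 #t d2) =
  tact (a1 * a2) (tmap phi (lam s (1 #t d1) (1 #t d2))).
Proof. by rewrite /pushout_prod (tlift_pure (outer_bilin _ _)) tlift_pure. Qed.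

Lemma pushout_prodE s a1 a2 l1 l2 :
  pushout_prod s (tact a1 (tmap phi l1)) (tact a2 (tmap phi l2)) =
  tact (a1 * a2) (tmap phi (lam s l1 l2)).
Proof.
have [lP rP] := pushout_prod_bilin s.
elim/tensor_ind: l1 => [|x x' hx hx'|b1 d1].
- rewrite (linf0 (tmap_linear lphi)) (linf0 (tact_linear _)) (linf0 (rP _)).
  by rewrite (linf0 (rlam s _)) (linf0 (tmap_linear lphi)) (linf0 (tact_linear _)).
- rewrite (linfD (tmap_linear lphi)) (linfD (tact_linear _)) (linfD (rP _)).
  rewrite hx hx' (linfD (rlam s _)) (linfD (tmap_linear lphi)).
  by rewrite (linfD (tact_linear _)).
elim/tensor_ind: l2 => [|x x' hx hx'|b2 d2].
- rewrite (linf0 (tmap_linear lphi)) (linf0 (tact_linear _)) (linf0 (lP _)).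
  by rewrite (linf0 (llam s _)) (linf0 (tmap_linear lphi)) (linf0 (tact_linear _)).
- rewrite (linfD (tmap_linear lphi)) (linfD (tact_linear _)) (linfD (lP _)).
  rewrite hx hx' (linfD (llam s _)) (linfD (tmap_linear lphi)).
  by rewrite (linfD (tact_linear _)).
rewrite !(tmap_pure _ _ lphi) !tact_pure pushout_prod_pure.
have [ml mr] := defm_abilin lam s.
have e b (d : D) : b #t d = tact b (1 #t d) + 0 :> A *t D.
  by rewrite addr0 tact_pure mulr1.
rewrite (e b1) ml (linf0 (rlam s _)) addr0 (e b2) mr (linf0 (llam s _)) addr0.
by rewrite !tmap_act !tactA; congr tact; rewrite mulrACA mulrA.
Qed.

Let gen_ind (P : A' *t D -> Prop) : P 0 ->
  (forall x y, P x -> P y -> P (x + y)) ->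
  (forall a l, P (tact a (tmap phi l))) -> forall x, P x.
Proof.
move=> P0 PD Pg; apply: tensor_ind => // a d.
by have := Pg a (1 #t d); rewrite (tmap_pure _ _ lphi) tact_pure rmorph1 mulr1.
Qed.

Let assoc_push s1 s2 t1 t2 :
  (forall x y z, lam s1 x (lam s2 y z) = lam t2 (lam t1 x y) z) ->
  forall x y z, pushout_prod s1 x (pushout_prod s2 y z) =
                pushout_prod t2 (pushout_prod t1 x y) z.
Proof.
move=> h.
have lP s x := (pushout_prod_bilin s).1 x.
have rP s y := (pushout_prod_bilin s).2 y.
move=> x y z.
elim/gen_ind: x => [|x x' hx hx'|a1 l1].
- by rewrite (linf0 (rP s1 _)) (linf0 (rP t1 _)) (linf0 (rP t2 _)).
- by rewrite (linfD (rP s1 _)) (linfD (rP t1 _)) (linfD (rP t2 _)) hx hx'.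
elim/gen_ind: y => [|x x' hx hx'|a2 l2].
- by rewrite (linf0 (rP s2 _)) (linf0 (lP s1 _)) (linf0 (lP t1 _)) (linf0 (rP t2 _)).
- rewrite (linfD (rP s2 _)) (linfD (lP s1 _)) (linfD (lP t1 _)).
  by rewrite (linfD (rP t2 _)) hx hx'.
elim/gen_ind: z => [|x x' hx hx'|a3 l3].
- by rewrite (linf0 (lP s2 _)) (linf0 (lP s1 _)) (linf0 (lP t2 _)).
- by rewrite (linfD (lP s2 _)) (linfD (lP s1 _)) (linfD (lP t2 _)) hx hx'.
by rewrite !pushout_prodE h mulrA.
Qed.

Lemma pushout_axioms : dialgebra_axioms pushout_prod.
Proof.
have ax := dprodP lam.
move=> x y z; split.
- by apply: assoc_push => u v w; case: (ax u v w).
- by apply/esym/assoc_push => u v w; case: (ax u v w).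
- by apply/esym/assoc_push => u v w; case: (ax u v w).
- by apply/esym/assoc_push => u v w; case: (ax u v w).
- by apply: assoc_push => u v w; case: (ax u v w).
Qed.

Lemma pushout_abilin s : abilin (pushout_prod s).
Proof.
have [lP rP] := pushout_prod_bilin s.
split=> [a x x' y|a x y y'].
- rewrite (linfD (rP y)); congr (_ + _).
  elim/gen_ind: x => [|x z hx hz|a1 l1].
  + by rewrite (linf0 (tact_linear _)) (linf0 (rP y)) (linf0 (tact_linear _)).
  + rewrite (linfD (tact_linear _)) !(linfD (rP y)) (linfD (tact_linear _)).
    by rewrite hx hz.
  elim/gen_ind: y => [|y z hy hz|a2 l2].
  + by rewrite !(linf0 (lP _)) (linf0 (tact_linear _)).
  + by rewrite !(linfD (lP _)) (linfD (tact_linear _)) hy hz.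
  by rewrite tactA !pushout_prodE tactA mulrA.
- rewrite (linfD (lP x)); congr (_ + _).
  elim/gen_ind: x => [|x z hx hz|a1 l1].
  + by rewrite !(linf0 (rP _)) (linf0 (tact_linear _)).
  + by rewrite !(linfD (rP _)) (linfD (tact_linear _)) hx hz.
  elim/gen_ind: y => [|y z hy hz|a2 l2].
  + by rewrite (linf0 (tact_linear _)) !(linf0 (lP _)) (linf0 (tact_linear _)).
  + rewrite (linfD (tact_linear _)) !(linfD (lP _)) (linfD (tact_linear _)).
    by rewrite hy hz.
  by rewrite tactA !pushout_prodE tactA mulrCA.
Qed.

Lemma pushout_aug s x y :
  taug eps' (pushout_prod s x y) = dD s (taug eps' x) (taug eps' y).
Proof.
have leps : scalar eps by exact: linearP.
have leps' : scalar eps' by exact: linearP.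
have [lP rP] := pushout_prod_bilin s.
have [lD rD] := dprod_bilin dD s.
have lE := @taug_linear K D A' eps' leps'.
have tE a (l : A *t D) : taug eps' (tact a (tmap phi l)) = eps' a *: taug eps l.
  elim/tensor_ind: l => [|u v hu hv|b d].
  - rewrite (linf0 (tmap_linear lphi)) (linf0 (tact_linear _)) (linf0 lE).
    by rewrite (linf0 (taug_linear leps)) scaler0.
  - rewrite (linfD (tmap_linear lphi)) (linfD (tact_linear _)) (linfD lE).
    by rewrite (linfD (taug_linear leps)) scalerDr hu hv.
  - rewrite (tmap_pure _ _ lphi) tact_pure !taug_pure // scalerA.
    by rewrite rmorphM -phi_eps.
elim/gen_ind: x => [|u v hu hv|a1 l1].
- by rewrite (linf0 (rP _)) (linf0 lE) (linf0 (rD _)).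
- by rewrite (linfD (rP _)) !(linfD lE) (linfD (rD _)) hu hv.
elim/gen_ind: y => [|u v hu hv|a2 l2].
- by rewrite (linf0 (lP _)) (linf0 lE) (linf0 (lD _)).
- by rewrite (linfD (lP _)) !(linfD lE) (linfD (lD _)) hu hv.
rewrite pushout_prodE !tE defm_aug (linfZ (rD _)) (linfZ (lD _)) scalerA.
by rewrite rmorphM.
Qed.

Definition pushout : deformation eps' :=
  @Deformation A' eps' (Dialgebra pushout_prod_bilin pushout_axioms)
    pushout_abilin pushout_aug.

End Pushout.

End Deformation.

Section Trees.
Local Open Scope nat_scope.

Inductive tree := Leaf | Graft of tree & tree.

Fixpoint nvert (t : tree) : nat :=
  if t is Graft l r then (nvert l + nvert r).+1 else 0.

(* The leaves of t are numbered 0, ..., nvert t from left to right, so that *)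
(* those of Graft l r lying in l are the ones with number <= nvert l.       *)
Fixpoint delete_leaf (i : nat) (t : tree) : tree :=
  match t with
  | Leaf => Leaf
  | Graft l r =>
      if i <= nvert l then
        (if l is Leaf then r else Graft (delete_leaf i l) r)
      else
        (if r is Leaf then l else Graft l (delete_leaf (i - (nvert l).+1) r))
  end.

(* Whether the i-th leaf is oriented like \, i.e. (roots being drawn at the *)
(* bottom) is the left input of its vertex.                                 *)
Fixpoint leaf_backslash (i : nat) (t : tree) : bool :=
  match t with
  | Leaf => false
  | Graft l r =>
      if i <= nvert l then (if l is Leaf then true else leaf_backslash i l)
      else (if r is Leaf then false else leaf_backslash (i - (nvert l).+1) r)
  end.

(* The product \circ_i^y, for a tree y whose last leaf has number nvert y   *)
Definition circ (i : nat) (y : tree) : dash :=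
  if i == 0 then (if y is Graft Leaf _ then dashv else vdash)
  else if i == nvert y then (if y is Graft _ Leaf then vdash else dashv)
  else if leaf_backslash i y then dashv else vdash.

Lemma nvert_delete_leaf i t : nvert (delete_leaf i t) = (nvert t).-1.
Proof.
elim: t i => [|l ihl r ihr] i //=.
case: ifP => _.
  by case: l ihl => [|l1 l2] ihl //=; rewrite ihl.
by case: r ihr => [|r1 r2] ihr /=; rewrite ?addn0 ?ihr //= addnS.
Qed.

Definition Y (n : nat) := {t : tree | nvert t == n}.

Lemma face_subproof n (i : nat) (y : Y n.+1) : nvert (delete_leaf i (val y)) == n.
Proof. by rewrite nvert_delete_leaf (eqP (valP y)). Qed.

Definition face n (i : nat) (y : Y n.+1) : Y n :=
  exist _ (delete_leaf i (val y)) (face_subproof i y).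

Definition t1 := Graft Leaf Leaf.
Definition t12 := Graft t1 Leaf.
Definition t21 := Graft Leaf t1.

Definition y123 : Y 3 := exist _ (Graft t12 Leaf) (eqxx _).
Definition y213 : Y 3 := exist _ (Graft t21 Leaf) (eqxx _).
Definition y131 : Y 3 := exist _ (Graft t1 t1) (eqxx _).
Definition y312 : Y 3 := exist _ (Graft Leaf t12) (eqxx _).
Definition y321 : Y 3 := exist _ (Graft Leaf t21) (eqxx _).

End Trees.

(* The cochain complex CY^*(D,D): linear maps from K[Y_n] (x) D^{(x) n} to  *)
(* D are given as families, indexed by Y_n, of n-linear maps D^n -> D.      *)

Section Cohomology.
Variables (K : fieldType) (D : lmodType K).

Definition upd n (a : 'I_n -> D) (j : 'I_n) (x : D) : 'I_n -> D :=
  fun i => if i == j then x else a i.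

Definition multilinear n (g : ('I_n -> D) -> D) : Prop :=
  forall a j, linear (fun x => g (upd a j x)).

Definition is_cochain n (f : Y n -> ('I_n -> D) -> D) : bool :=
  `[< forall y, multilinear (f y) >].

Lemma is_cochain_submod n : submod_closed (@is_cochain n).
Proof.
split.
  by apply/asboolP => y a j k x x' /=; rewrite scaler0 addr0.
move=> c f g /asboolP hf /asboolP hg; apply/asboolP => y a j k x x'.
have E u : (c *: f + g) y u = c *: f y u + g y u by [].
rewrite !E; have /= -> := hf y a j k x x'; have /= -> := hg y a j k x x'.
by rewrite !scalerDr !scalerA addrACA [c * k]mulrC.
Qed.

HB.instance Definition _ n :=
  GRing.isSubmodClosed.Build K (Y n -> ('I_n -> D) -> D) (@is_cochain n)
    (@is_cochain_submod n).

Record CY n := Cochain { cfun :> Y n -> ('I_n -> D) -> D; _ : is_cochain cfun }.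

HB.instance Definition _ n := [isSub for @cfun n].
HB.instance Definition _ n := [Choice of CY n by <:].
HB.instance Definition _ n := [SubChoice_isSubLmodule of CY n by <:].

Lemma CY_multilinear n (f : CY n) y : multilinear (f y).
Proof. by case: f => f /= /asboolP. Qed.

Variable dD : dialgebra D.

(* (a_0, ..., o a_k a_{k+1}, ..., a_n) *)
Definition contract n (o : D -> D -> D) (k : nat) (a : 'I_n.+1 -> D) : 'I_n -> D :=
  fun j => if (j < k)%N then a (widen_ord (leqnSn n) j)
           else if j == k :> nat then o (a (widen_ord (leqnSn n) j)) (a (lift ord0 j))
           else a (lift ord0 j).

(* delta^i.  The arguments a_1, ..., a_{n+1} of the usual notation are      *)
(* numbered from 0 here.                                                    *)
Definition coface n (f : Y n -> ('I_n -> D) -> D) (i : nat)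
    (y : Y n.+1) (a : 'I_n.+1 -> D) : D :=
  let o := dD (circ i (val y)) in
  if i == 0%N then o (a ord0) (f (face i y) (fun j => a (lift ord0 j)))
  else if i == n.+1%N then
    o (f (face i y) (fun j => a (widen_ord (leqnSn n) j))) (a ord_max)
  else f (face i y) (contract o i.-1 a).

Definition deltaf n (f : Y n -> ('I_n -> D) -> D) : Y n.+1 -> ('I_n.+1 -> D) -> D :=
  fun y a => \sum_(i < n.+2) (-1) ^+ i *: coface f i y a.

Lemma upd_lift0 n (a : 'I_n.+1 -> D) j x :
  (fun i => upd a (lift ord0 j) x (lift ord0 i)) =
  upd (fun i => a (lift ord0 i)) j x.
Proof. by apply/funext => i; rewrite /upd (inj_eq lift_inj). Qed.

Lemma upd_widen n (a : 'I_n.+1 -> D) (j : 'I_n) x :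
  (fun i => upd a (widen_ord (leqnSn n) j) x (widen_ord (leqnSn n) i)) =
  upd (fun i => a (widen_ord (leqnSn n) i)) j x.
Proof. by apply/funext => i; rewrite /upd. Qed.

Lemma upd_contract n o k (a : 'I_n.+1 -> D) j : bilin o -> (k < n)%N ->
  exists (j' : 'I_n) (h : D -> D), linear h /\
    forall x, contract o k (upd a j x) = upd (contract o k a) j' (h x).
Proof.
move=> [ol or] kn.
have jn := ltn_ord j.
have [jk|kj|jk] := ltngtP j k.
- exists (Ordinal (ltn_trans jk kn)), id; split=> // x.
  apply/funext => i; rewrite /contract /upd -!val_eqE /= /bump leq0n add1n.
  case: ltngtP => ik.
  + by [].
  + have -> : (i.+1 == j) = false by apply/eqP => e; move: jk; rewrite -e; lia.
    by have -> : (nat_of_ord i == j) = false by apply/eqP; lia.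
  + have -> : (i.+1 == j) = false by apply/eqP; lia.
    by have -> : (nat_of_ord i == j) = false by apply/eqP; lia.
- have [e|ne] := eqVneq (nat_of_ord j) k.+1.
    exists (Ordinal kn), (o (a (widen_ord (leqnSn n) (Ordinal kn)))); split=> // x.
    apply/funext => i; rewrite /contract /upd -!val_eqE /= /bump leq0n add1n e eqSS.
    case: ltngtP => ik //.
    + by have -> : (nat_of_ord i == k.+1) = false by apply/eqP; lia.
    + have -> : (nat_of_ord i == k.+1) = false by apply/eqP; lia.
      by congr (o (a _) _); apply: val_inj.
  have jn' : (j.-1 < n)%N by lia.
  exists (Ordinal jn'), id; split=> // x.
  apply/funext => i; rewrite /contract /upd -!val_eqE /= /bump leq0n add1n.
  have -> : (i.+1 == j) = (nat_of_ord i == j.-1) by apply/eqP/eqP; lia.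
  case: ltngtP => ik //.
  + have -> : (nat_of_ord i == j) = false by apply/eqP; lia.
    by have -> : (nat_of_ord i == j.-1) = false by apply/eqP; lia.
  + have -> : (nat_of_ord i == j) = false by apply/eqP; lia.
    by have -> : (nat_of_ord i == j.-1) = false by apply/eqP; lia.
- exists (Ordinal kn), (fun x => o x (a (lift ord0 (Ordinal kn)))); split=> [|x].
    exact: or.
  apply/funext => i; rewrite /contract /upd -!val_eqE /= /bump leq0n add1n jk.
  case: ltngtP => ik //.
  + by have -> : (i.+1 == k) = false by apply/eqP; lia.
  + have -> : (i.+1 == k) = false by apply/eqP; lia.
    by congr (o _ (a _)); apply: val_inj; rewrite /= ik.
Qed.

Lemma coface_multilinear n (f : CY n) i (y : Y n.+1) : (i < n.+2)%N ->
  multilinear (coface f i y).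
Proof.
move=> lti a j; have [ol or] := dprod_bilin dD (circ i (val y)).
have fml z := CY_multilinear f z.
rewrite /coface; case: eqVneq => [_|i0].
  have [j'|->] := unliftP ord0 j.
    have e x : upd a (lift ord0 j') x ord0 = a ord0 by [].
    move=> -> k x x' /=; rewrite !upd_lift0 (fml _ _ _ k) !e; exact: ol.
  have e x : (fun i => upd a ord0 x (lift ord0 i)) = (fun i => a (lift ord0 i)).
    by apply/funext.
  by move=> k x x' /=; rewrite !e /upd eqxx; exact: or.
case: eqVneq => [_|i1].
  have [jn|jn] := ltnP j n.
    have -> : j = widen_ord (leqnSn n) (Ordinal jn) by apply: val_inj.
    have e x : upd a (widen_ord (leqnSn n) (Ordinal jn)) x ord_max = a ord_max.
      by rewrite /upd -val_eqE /= gtn_eqF.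
    move=> k x x' /=; rewrite !upd_widen (fml _ _ _ k) !e; exact: or.
  have -> : j = ord_max by apply: val_inj; have := ltn_ord j => /=; lia.
  have e x : (fun i => upd a ord_max x (widen_ord (leqnSn n) i)) =
             (fun i => a (widen_ord (leqnSn n) i)).
    by apply/funext => u; rewrite /upd -val_eqE /= ltn_eqF.
  by move=> k x x' /=; rewrite !e /upd eqxx; exact: ol.
have [||j' [h [hl e]]] := @upd_contract n (dD (circ i (val y))) i.-1 a j.
- exact: dprod_bilin.
- lia.
by move=> k x x' /=; rewrite !e hl (fml _ _ _ k).
Qed.

Lemma deltaf_cochain n (f : CY n) : is_cochain (deltaf f).
Proof.
apply/asboolP => y a j k x x'; rewrite /deltaf scaler_sumr -big_split /=.
apply: eq_bigr => i _; have /= -> := coface_multilinear f y (ltn_ord i) a j k x x'; rewrite scalerDr.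
by rewrite !scalerA [_ * k]mulrC.
Qed.

Definition delta n (f : CY n) : CY n.+1 := Cochain (deltaf_cochain f).

Lemma coface_linear n i y a :
  linear (fun f : Y n -> ('I_n -> D) -> D => coface f i y a).
Proof.
have [ol or] := dprod_bilin dD (circ i (val y)).
move=> k f g; rewrite /coface; case: ifP => _; first exact: ol.
by case: ifP => _; [exact: or|].
Qed.

Lemma delta_linear n : linear (@delta n).
Proof.
move=> k f g; apply: val_inj; apply/funext => y; apply/funext => a /=.
transitivity (k *: deltaf f y a + deltaf g y a); last by [].
rewrite /deltaf scaler_sumr -big_split /=; apply: eq_bigr => i _.
by rewrite coface_linear scalerDr !scalerA [_ * k]mulrC.
Qed.

HB.instance Definition _ n :=
  GRing.isLinear.Build K (CY n) (CY n.+1) *:%R (@delta n) (@delta_linear n).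

Definition is_cocycle n (f : CY n) : bool := delta f == 0.

Lemma is_cocycle_submod n : submod_closed (@is_cocycle n).
Proof.
split; first by rewrite unfold_in /is_cocycle linear0.
move=> k f g; rewrite !unfold_in /is_cocycle delta_linear.
by move=> /eqP -> /eqP ->; rewrite scaler0 addr0.
Qed.

HB.instance Definition _ n :=
  GRing.isSubmodClosed.Build K (CY n) (@is_cocycle n) (@is_cocycle_submod n).

Record ZY n := Cocycle { cocycle_val :> CY n; _ : is_cocycle cocycle_val }.

HB.instance Definition _ n := [isSub for @cocycle_val n].
HB.instance Definition _ n := [Choice of ZY n by <:].
HB.instance Definition _ n := [SubChoice_isSubLmodule of ZY n by <:].

Definition is_coboundary n : ZY n -> bool :=
  match n with
  | 0 => fun f => f == 0
  | m.+1 => fun f => `[< exists g : CY m, cocycle_val f = delta g >]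
  end.

Lemma is_coboundary_zmod n : zmod_closed (@is_coboundary n).
Proof.
case: n => [|n]; split.
- exact: eqxx.
- by move=> f g; rewrite !unfold_in /= => /eqP -> /eqP ->; rewrite subrr.
- by apply/asboolP; exists 0; rewrite linear0.
- move=> f g /asboolP [u hu] /asboolP [v hv]; apply/asboolP.
  exists (u - v); transitivity (cocycle_val f - cocycle_val g); first by [].
  by rewrite hu hv; exact/esym/linearB.
Qed.

HB.instance Definition _ n :=
  GRing.isZmodClosed.Build (ZY n) (@is_coboundary n) (@is_coboundary_zmod n).

Definition BY n : zmodClosed (ZY n) :=
  GRing.ZmodClosed.clone (ZY n) (@is_coboundary n) _.

Definition HY n := Quotient.quot (BY n).

Definition HYcl n (f : ZY n) : HY n := \pi_(HY n) f.

Lemma HYcl_eq0 n (f : ZY n) : (HYcl f == 0) = is_coboundary f.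
Proof.
by rewrite -[0]pi_zeror /HYcl -Quotient.idealrBE subr0.
Qed.

End Cohomology.

Arguments HYcl {K D dD n}.

Definition finite_dim (K : fieldType) (A : lmodType K) : Prop :=
  exists n (v2r : A -> 'rV[K]_n), linear v2r /\ bijective v2r.

Definition ideal (R : comNzRingType) (I : set R) : Prop :=
  [/\ I 0, forall x y, I x -> I y -> I (x + y) & forall a x, I x -> I (a * x)].

Definition maximal_ideal (R : comNzRingType) (I : set R) : Prop :=
  [/\ ideal I, ~ I 1 &
      forall J : set R, ideal J -> ~ J 1 -> (I `<=` J)%classic -> J = I].

Definition local_ring (R : comNzRingType) : Prop :=
  exists! I : set R, maximal_ideal I.

(* The second Harrison cohomology of A with coefficients in K.  A 2-cochain *)
(* of the Hochschild complex is a Harrison cochain when it vanishes on the  *)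
(* shuffles a (x) b - b (x) a; every 1-cochain is a Harrison cochain.       *)

Section Harrison.
Variables (K : fieldType) (A : comAlgType K) (eps : {lrmorphism A -> K^o}).

Definition harr_cocycle (f : A -> A -> K^o) : Prop :=
  [/\ bilin f, forall a b, f a b = f b a &
      forall a b c,
        eps a * f b c - f (a * b) c + f a (b * c) - f a b * eps c = 0].

Definition is_harr_cocycle (f : A -> A -> K^o) : bool := `[< harr_cocycle f >].

Lemma is_harr_cocycle_zmod : zmod_closed is_harr_cocycle.
Proof.
split.
  apply/asboolP; split=> //.
    by split=> u k x y; rewrite [RHS]addr0 [RHS]scaler0.
  by move=> a b c; rewrite mulr0 mul0r !subr0 addr0.
move=> f g /asboolP [[fl fr] fs fc] /asboolP [[gl gr] gs gc]; apply/asboolP.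
have E a b : (f - g) a b = f a b - g a b by [].
split.
- split=> [u k x y|v k x y]; rewrite !E.
  + by rewrite (fl u) (gl u) scalerBr opprD addrACA.
  + have /= -> := fr v k x y; have /= -> := gr v k x y.
    by rewrite scalerBr opprD addrACA.
- by move=> a b; rewrite !E fs gs.
- move=> a b c; rewrite !E -[RHS](subr0 0) -{1}(fc a b c) -(gc a b c).
  rewrite mulrBr mulrBl !opprD !opprK !addrA; ring.
Qed.

HB.instance Definition _ :=
  GRing.isZmodClosed.Build (A -> A -> K^o) is_harr_cocycle is_harr_cocycle_zmod.

Record ZHarr2 := HarrCocycle {
  harr_val :> A -> A -> K^o; _ : is_harr_cocycle harr_val }.

HB.instance Definition _ := [isSub for harr_val].
HB.instance Definition _ := [Choice of ZHarr2 by <:].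
HB.instance Definition _ := [SubChoice_isSubZmodule of ZHarr2 by <:].

Definition is_harr_coboundary (f : ZHarr2) : bool :=
  `[< exists2 g : A -> K^o, linear g &
        forall a b, f a b = eps a * g b - g (a * b) + g a * eps b >].

Lemma is_harr_coboundary_zmod : zmod_closed is_harr_coboundary.
Proof.
split.
  apply/asboolP; exists (fun _ => 0).
    by move=> k x y; rewrite scaler0 addr0.
  by move=> a b; rewrite mulr0 mul0r subr0 addr0.
move=> f f' /asboolP [g lg hg] /asboolP [g' lg' hg']; apply/asboolP.
exists (fun a => g a - g' a).
  by move=> k x y; rewrite lg lg' scalerBr opprD addrACA.
move=> a b; transitivity (f a b - f' a b); first by [].
by rewrite hg hg'; ring.
Qed.

HB.instance Definition _ := GRing.isZmodClosed.Build ZHarr2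
  is_harr_coboundary is_harr_coboundary_zmod.

Definition BHarr2 : zmodClosed ZHarr2 :=
  GRing.ZmodClosed.clone ZHarr2 is_harr_coboundary _.

Definition HHarr2 := Quotient.quot BHarr2.

Definition HHarr2cl (f : ZHarr2) : HHarr2 := \pi_HHarr2 f.

Record extension := Extension {
  ext_alg :> comAlgType K;
  ext_i : {linear K^o -> ext_alg};
  ext_p : {lrmorphism ext_alg -> A};
  ext_i_inj : injective ext_i;
  ext_p_surj : forall a, exists b, ext_p b = a;
  ext_exact : forall b, ext_p b = 0 <-> exists k, b = ext_i k;
  ext_module : forall b k, b * ext_i k = ext_i (eps (ext_p b) * k) }.

Definition ext_eps (B : extension) : {lrmorphism B -> K^o} :=
  GRing.LRMorphism.clone _ _ _ _ (eps \o ext_p B) _.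

(* B corresponds to the class of the cocycle f when, for some linear        *)
(* section q of p, q a * q b = q (a * b) + i (f a b).                       *)
Definition ext_corresponds (B : extension) (c : HHarr2) : Prop :=
  exists (q : A -> B) (f : ZHarr2),
    [/\ linear q, cancel q (ext_p B),
        forall a b, q a * q b = q (a * b) + ext_i B (f a b) &
        HHarr2cl f = c].

End Harrison.

Section Obstruction.
Variables (K : fieldType) (D : lmodType K) (dD : dialgebra D).
Variables (A : comAlgType K) (eps : {lrmorphism A -> K^o}).
Variable lam : deformation dD eps.

Section Extension.
Variable B : extension eps.

(* I = i (x) id, with K (x) D identified with D *)
Definition mapI (l : D) : B *t D := ext_i B 1 #t l.
Definition mapP : B *t D -> A *t D := tmap (ext_p B).
Definition mapE : B *t D -> D := taug (ext_eps B).

Definition lifted_ops (br : dash -> B *t D -> B *t D -> B *t D) : Prop :=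
  [/\ forall s, abilin (br s),
      forall s l1 l2, mapP (br s l1 l2) = lam s (mapP l1) (mapP l2) &
      forall s l l1, br s (mapI l) l1 = mapI (dD s l (mapE l1))].

(* c is the cochain induced by the maps phi(y; -, -, -) built from br       *)
Definition obstruction_cochain (br : dash -> B *t D -> B *t D -> B *t D)
    (c : CY D 3) : Prop :=
  let l := br dashv in let r := br vdash in
  forall l1 l2 l3 : B *t D,
  let c' y := mapI (c y (tnth [tuple mapE l1; mapE l2; mapE l3])) in
  [/\ c' y321 = l l1 (l l2 l3) - l (l l1 l2) l3,
      c' y312 = l l1 (r l2 l3) - l (l l1 l2) l3,
      c' y131 = r l1 (l l2 l3) - l (r l1 l2) l3,
      c' y213 = r l1 (r l2 l3) - r (l l1 l2) l3 &
      c' y123 = r l1 (r l2 l3) - r (r l1 l2) l3].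

End Extension.

Definition is_obstruction (f : HHarr2 eps) (h : HY dD 3) : Prop :=
  exists (B : extension eps) (br : dash -> B *t D -> B *t D -> B *t D)
    (c : ZY dD 3),
    [/\ ext_corresponds B f, lifted_ops br,
        obstruction_cochain br c & h = HYcl c].

(* is_obstruction f h has exactly one solution h, whatever the choices of B *)
(* and br; the 0 below is only the default value demanded by xget.          *)
Definition obstruction (f : HHarr2 eps) : HY dD 3 :=
  xget 0 (fun h => is_obstruction f h).

End Obstruction.

(* Main.v *)
Require Import Defs.
From mathcomp Require Import all_boot all_order all_algebra.
From HB Require Import structures.
From mathcomp Require Import boolp classical_sets.
From mathcomp Require Import zify ring.

Set Implicit Arguments.
Unset Strict Implicit.
Unset Printing Implicit Defensive.

Import GRing.Theory.
Local Open Scope ring_scope.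

(** Write I for the inclusion of [D] in [B (x) D] as a square-zero ideal, P for
    the projection to [A (x) D] and E for the augmentation to [D].

    A dialgebra is a vector space with one associativity law for each of the
    five trees [y] with three vertices: the law at [y] says that
    [assoc m y x1 x2 x3], the difference of the two ways to bracket a product
    of three factors with the operations that the leaves of [y] prescribe,
    vanishes ([dialgebra_assocP]).  In these terms the theorem is the usual
    obstruction argument for associative algebras, carried out for all trees at
    once.

    Lift the products of [lam] to [B]-bilinear operations on [B (x) D]; this is
    possible because such operations are determined by arbitrary values on
    [D x D] ([lifted_ops_exist]).  Their associators vanish after applying P,
    so they take values in I(D); a [B]-linear map with values there depends only
    on the E-image of its argument ([alin_ker_aug]), because the augmentation
    ideal of [B] kills I(D).  So the associators are induced by a cochain on [D].
    It is a cocycle by the pentagon: applying the coboundary gives ten bracketings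
    of four factors, which cancel in pairs since the operations around each
    bracketing are related by the simplicial identities of the faces
    ([circ_faces], [induced_cocycle]).

    For the same reason two lifts differ by I(psi(E, E)) for a 2-cochain [psi]
    ([lifts_differ]), and conversely each [psi] changes a lift into another one
    ([twist_lifted]).  Since I(D) squares to zero, the change of the associators
    is exactly I applied to the coboundary of [psi] ([assoc_twist]).  Hence some
    lift is associative, that is, [lam] extends over [B], if and only if the
    obstruction cochain of one given lift is a coboundary.

    The obstruction class is computed from an unspecified extension with the
    given Harrison class.  Cohomologous cocycles give a morphism between the
    extensions over [A] ([ext_hom]), along which extensions of [lam] are pushed
    out, so extendability depends on the class only ([extendable_class]). *)

(** * The operations attached to trees with two, three and four vertices *)

Section Trees.
Local Open Scope nat_scope.

Lemma tree_split n (Q : tree -> Prop) :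
  (forall i l r, i <= n -> nvert l = i -> nvert r = n - i -> Q (Graft l r)) ->
  forall t, nvert t = n.+1 -> Q t.
Proof. by move=> h [|l r] //= [e]; apply: (h (nvert l)) => //; lia. Qed.

Lemma tree_ind0 (Q : tree -> Prop) : Q Leaf -> forall t, nvert t = 0 -> Q t.
Proof. by move=> h []. Qed.

Lemma tree_ind1 (Q : tree -> Prop) : Q t1 -> forall t, nvert t = 1 -> Q t.
Proof.
move=> h; apply: tree_split => -[|//] l r _ hl.
by move: r; apply: tree_ind0; move: l hl; apply: tree_ind0.
Qed.

Lemma tree_ind2 (Q : tree -> Prop) : Q t21 -> Q t12 ->
  forall t, nvert t = 2 -> Q t.
Proof.
move=> h1 h2; apply: tree_split => -[|[|//]] l r _.
- by move=> hl; move: r; apply: tree_ind1; move: l hl; apply: tree_ind0.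
- by move=> hl; move: r; apply: tree_ind0; move: l hl; apply: tree_ind1.
Qed.

Lemma tree_ind3 (Q : tree -> Prop) :
  Q (val y321) -> Q (val y312) -> Q (val y131) -> Q (val y213) -> Q (val y123) ->
  forall t, nvert t = 3 -> Q t.
Proof.
move=> h1 h2 h3 h4 h5; apply: tree_split => -[|[|[|//]]] l r _.
- by move=> hl; move: r; apply: tree_ind2; move: l hl; apply: tree_ind0.
- by move=> hl; move: r; apply: tree_ind1; move: l hl; apply: tree_ind1.
- by move=> hl; move: r; apply: tree_ind0; move: l hl; apply: tree_ind2.
Qed.

(** The 2-tree that indexes a product: the component of a 2-cochain at
    [tree2 s] is an infinitesimal change of the product [s]. *)
Definition tree2 (s : dash) : Y 2 :=
  if s is dashv then exist _ t21 (eqxx _) else exist _ t12 (eqxx _).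

(** The operation that remains outside or inside a bracket is the one of the
    2-tree left when the leaf between the bracketed factors, or the factor
    outside the bracket, is deleted.  This matches the coboundary of a 2-cochain
    with the first-order variation of the associators. *)
Lemma face3E (y : Y 3) :
  [/\ face 0 y = tree2 (circ 2 (val y)), face 1 y = tree2 (circ 3 (val y)),
      face 2 y = tree2 (circ 0 (val y)) & face 3 y = tree2 (circ 1 (val y))].
Proof.
case: y => t ht; have e := eqP ht.
by move: t e ht; apply: tree_ind3 => ht; split; apply: val_inj.
Qed.

(** Each of the five bracketings of four factors occurs in two of the five
    terms of the coboundary of the associator; each block below says that the
    three operations involved are the same in both.  In order, the bracketings
    are a(b(cd)), a((bc)d), (ab)(cd), (a(bc))d and ((ab)c)d. *)
Lemma circ_faces (y : Y 4) (t := val y) (d := fun i => val (face i y)) :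
  [/\ [/\ circ 0 t = circ 0 (d 3), circ 0 (d 0) = circ 2 (d 3) &
          circ 2 (d 0) = circ 3 t],
      [/\ circ 0 t = circ 0 (d 2), circ 3 (d 0) = circ 2 (d 2) &
          circ 1 (d 0) = circ 2 t],
      [/\ circ 0 (d 1) = circ 3 (d 3), circ 1 t = circ 1 (d 3) &
          circ 2 (d 1) = circ 3 t],
      [/\ circ 3 (d 2) = circ 4 t, circ 1 (d 2) = circ 0 (d 4) &
          circ 2 t = circ 2 (d 4)] &
      [/\ circ 3 (d 1) = circ 4 t, circ 1 (d 1) = circ 3 (d 4) &
          circ 1 t = circ 1 (d 4)]].
Proof.
rewrite {}/d {}/t; case: y => t ht /=; move: t {ht}(eqP ht).
apply: tree_split => -[|[|[|[|//]]]] l r _.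
- by move=> hl; move: r; apply: tree_ind3; move: l hl; apply: tree_ind0.
- by move=> hl; move: r; apply: tree_ind2; move: l hl; apply: tree_ind1.
- by move=> hl; move: r; apply: tree_ind1; move: l hl; apply: tree_ind2.
- by move=> hl; move: r; apply: tree_ind0; move: l hl; apply: tree_ind3.
Qed.
End Trees.

(** * Dialgebra axioms and coboundaries in terms of trees *)

Section Associator.

(** The operation labels 0 and 3 sit at the outer leaves, and so act last; the
    labels 1 and 2 sit between two factors that are multiplied first. *)
Definition assoc (V : zmodType) (m : dash -> V -> V -> V) (t : tree)
    (x y z : V) : V :=
  m (circ 0 t) x (m (circ 2 t) y z) - m (circ 3 t) (m (circ 1 t) x y) z.

Lemma dialgebra_assocP (V : zmodType) (m : dash -> V -> V -> V) :
  dialgebra_axioms m <->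
  forall (y : Y 3) x1 x2 x3, assoc m (val y) x1 x2 x3 = 0.
Proof.
split=> [h y x1 x2 x3|h x1 x2 x3].
  have [h1 h2 h3 h4 h5] := h x1 x2 x3.
  case: y => t /= /eqP; move: t.
  by apply: tree_ind3; rewrite /assoc /circ /=; apply/eqP; rewrite subr_eq0;
    apply/eqP.
have e (y : Y 3) := subr0_eq (h y x1 x2 x3).
move: (e y321) (e y312) (e y131) (e y213) (e y123).
by rewrite /circ /= => -> -> -> -> ->.
Qed.

End Associator.

Section Cochains.
Variables (K : fieldType) (D : lmodType K).

Definition args2 (a b : D) : 'I_2 -> D := tnth [tuple a; b].
Definition args3 (a b c : D) : 'I_3 -> D := tnth [tuple a; b; c].
Definition args4 (a b c d : D) : 'I_4 -> D := tnth [tuple a; b; c; d].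

Variable dD : dialgebra D.

Lemma delta2E (f : CY D 2) (y : Y 3) a b c (o := fun i => dD (circ i (val y))) :
  delta dD f y (args3 a b c) =
  o 0%N a (f (face 0 y) (args2 b c)) - f (face 1 y) (args2 (o 1%N a b) c)
  + f (face 2 y) (args2 a (o 2%N b c)) - o 3%N (f (face 3 y) (args2 a b)) c.
Proof.
rewrite /= /deltaf !big_ord_recl big_ord0 /coface /= !addr0.
rewrite !addrA !exprS !expr0 !mulr1 !mulN1r !opprK !scale1r !scaleN1r.
by congr (o _ _ (f _ _) - f _ _ + f _ _ - o _ (f _ _) _);
  apply/funext => -[[|[|//]] i].
Qed.

Lemma delta3E (f : CY D 3) (y : Y 4) a b c d (o := fun i => dD (circ i (val y))) :
  delta dD f y (args4 a b c d) =
  o 0%N a (f (face 0 y) (args3 b c d)) - f (face 1 y) (args3 (o 1%N a b) c d)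
  + f (face 2 y) (args3 a (o 2%N b c) d) - f (face 3 y) (args3 a b (o 3%N c d))
  + o 4%N (f (face 4 y) (args3 a b c)) d.
Proof.
rewrite /= /deltaf !big_ord_recl big_ord0 /coface /= !addr0.
rewrite !addrA !exprS !expr0 !mulr1 !mulN1r !opprK !scale1r !scaleN1r.
by congr (o _ _ (f _ _) - f _ _ + f _ _ - f _ _ + o _ (f _ _) _);
  apply/funext => -[[|[|[|//]]] i].
Qed.

Lemma args3E (a : 'I_3 -> D) :
  a = args3 (a ord0) (a (lift ord0 ord0)) (a ord_max).
Proof.
by apply/funext => -[[|[|[|//]]] i]; rewrite /args3 (tnth_nth 0) /=;
  congr (a _); exact: val_inj.
Qed.

Lemma args4E (a : 'I_4 -> D) :
  a = args4 (a ord0) (a (lift ord0 ord0)) (a (lift ord0 (lift ord0 ord0)))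
            (a ord_max).
Proof.
by apply/funext => -[[|[|[|[|//]]]] i]; rewrite /args4 (tnth_nth 0) /=;
  congr (a _); exact: val_inj.
Qed.

Lemma bilin_multilinear (g : D -> D -> D) : bilin g ->
  multilinear (fun a : 'I_2 -> D => g (a ord0) (a ord_max)).
Proof.
by move=> [gl gr] a [[|[|//]] i] k x x'; rewrite /upd /=;
  [exact: gr | exact: gl].
Qed.

Lemma trilin_multilinear (g : D -> D -> D -> D) :
  (forall b c, linear (fun a => g a b c)) ->
  (forall a c, linear (fun b => g a b c)) ->
  (forall a b, linear (g a b)) ->
  multilinear (fun a : 'I_3 -> D => g (a ord0) (a (lift ord0 ord0)) (a ord_max)).
Proof.
by move=> g1 g2 g3 a [[|[|[|//]]] i] k x x'; rewrite /upd /=;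
  [exact: g1 | exact: g2 | exact: g3].
Qed.

Lemma multilinear_bilin (f : CY D 2) y : bilin (fun a b => f y (args2 a b)).
Proof.
have u0 a b x : upd (args2 a b) ord0 x = args2 x b.
  by apply/funext => -[[|[|//]] i].
have u1 a b x : upd (args2 a b) ord_max x = args2 a x.
  by apply/funext => -[[|[|//]] i].
split=> [a k x x'|b k x x'].
  by have := CY_multilinear f y (args2 a 0) ord_max k x x'; rewrite !u1.
by have := CY_multilinear f y (args2 0 b) ord0 k x x'; rewrite !u0.
Qed.

End Cochains.

(** * Multilinear operations over the base algebra *)

Lemma linfB (K : fieldType) (U V : lmodType K) (g : U -> V) : linear g ->
  forall x y, g (x - y) = g x - g y.
Proof. by move=> lg x y; rewrite -scaleN1r addrC lg scaleN1r addrC. Qed.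

Section BaseLinear.
Variables (K : fieldType) (D : lmodType K) (B : comAlgType K).

Definition alin (F : B *t D -> B *t D) : Prop :=
  forall b x x', F (tact b x + x') = tact b (F x) + F x'.

Lemma alin_linear F : alin F -> linear F.
Proof. by move=> h k x x'; rewrite -!tactZ. Qed.

Lemma tactB_rearrange b (u u' v v' : B *t D) :
  tact b u + u' - (tact b v + v') = tact b (u - v) + (u' - v').
Proof. by rewrite (linfB (tact_linear _)) opprD addrACA. Qed.

Lemma assoc_alin (br : dash -> B *t D -> B *t D -> B *t D) t :
  (forall s, abilin (br s)) ->
  [/\ forall y z, alin (fun x => assoc br t x y z),
      forall x z, alin (fun y => assoc br t x y z) &
      forall x y, alin (assoc br t x y)].
Proof.
move=> hb; have hl s := (hb s).1; have hr s := (hb s).2.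
by split=> [y z|x z|x y] b u v; rewrite /assoc !(hl, hr) tactB_rearrange.
Qed.

Lemma abilin_pure (m : B *t D -> B *t D -> B *t D) a d b e :
  abilin m -> m (a #t d) (b #t e) = tact (a * b) (m (1 #t d) (1 #t e)).
Proof.
move=> hm; have [lm rm] := abilin_bilin hm.
have := hm.1 a (1 #t d) 0 (b #t e).
rewrite addr0 (linf0 (rm _)) addr0 tact_pure mulr1 => ->.
have := hm.2 b (1 #t d) (1 #t e) 0.
by rewrite addr0 (linf0 (lm _)) addr0 tact_pure mulr1 => ->; rewrite tactA.
Qed.

Lemma tensor_ext2 (W : lmodType K) (f g : B *t D -> B *t D -> W) :
  bilin f -> bilin g ->
  (forall a d b e, f (a #t d) (b #t e) = g (a #t d) (b #t e)) ->
  forall x y, f x y = g x y.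
Proof.
move=> [lf rf] [lg rg] h x y; move: x; apply: tensor_ext => // a d.
by move: y; apply: tensor_ext.
Qed.

Section Extend.
Variable m : D -> D -> B *t D.
Hypothesis m_bilin : bilin m.

(** The [B]-bilinear operation on [B (x) D] with prescribed values on [D x D]. *)
Definition bext (x y : B *t D) : B *t D :=
  tlift (fun b1 d1 => tlift (fun b2 d2 => tact (b1 * b2) (m d1 d2)) y) x.

Let inner b1 d1 : bilin (fun b2 d2 => tact (b1 * b2) (m d1 d2)).
Proof.
split=> [b k d d'|d k b b'].
- by rewrite (m_bilin.1 d1) tact_linear.
- by rewrite mulrDr tactD -!tactZ tactA mulrCA -scalerAl mul1r -scalerAr.
Qed.

Let outer y : bilin (fun b1 d1 =>
  tlift (fun b2 d2 => tact (b1 * b2) (m d1 d2)) y).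
Proof.
split=> [b1 k d d'|d1 k b b']; move: y; apply: tensor_ext.
- exact/tlift_linear/inner.
- move=> c u v /=; rewrite !(tlift_linear (inner _ _)) !scalerDr !scalerA.
  by rewrite [k * c]mulrC addrACA.
- by move=> b2 d2; rewrite !(tlift_pure (inner _ _)) (m_bilin.2 d2) tact_linear.
- exact/tlift_linear/inner.
- move=> c u v /=; rewrite !(tlift_linear (inner _ _)) !scalerDr !scalerA.
  by rewrite [k * c]mulrC addrACA.
- move=> b2 d2; rewrite !(tlift_pure (inner _ _)) mulrDl tactD -!tactZ tactA.
  by rewrite -scalerAl -scalerAl mul1r.
Qed.

Lemma bext_pure b1 d1 b2 d2 :
  bext (b1 #t d1) (b2 #t d2) = tact (b1 * b2) (m d1 d2).
Proof. by rewrite /bext (tlift_pure (outer _)) tlift_pure. Qed.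

Lemma bext_bilin : bilin bext.
Proof.
split=> [x|y]; last exact: tlift_linear (outer y).
move=> k y y'; move: x; apply: tensor_ext.
- exact: tlift_linear (outer _).
- move=> c u v /=; rewrite /bext !(tlift_linear (outer _)) !scalerDr !scalerA.
  by rewrite [k * c]mulrC addrACA.
- by move=> b d; rewrite /bext !(tlift_pure (outer _)) (tlift_linear (inner _ _)).
Qed.

Lemma bext_abilin : abilin bext.
Proof.
have [lb rb] := bext_bilin.
split=> [b x x' y|b x y y'].
- rewrite (linfD (rb y)); congr (_ + _).
  elim/tensor_ind: x => [|u v hu hv|b1 d1].
  + by rewrite (linf0 (tact_linear _)) (linf0 (rb _)) (linf0 (tact_linear _)).
  + by rewrite (linfD (tact_linear _)) !(linfD (rb _)) (linfD (tact_linear _)) hu hv.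
  elim/tensor_ind: y => [|u v hu hv|b2 d2].
  + by rewrite !(linf0 (lb _)) (linf0 (tact_linear _)).
  + by rewrite !(linfD (lb _)) (linfD (tact_linear _)) hu hv.
  by rewrite tact_pure !bext_pure tactA mulrA.
- rewrite (linfD (lb x)); congr (_ + _).
  elim/tensor_ind: x => [|u v hu hv|b1 d1].
  + by rewrite !(linf0 (rb _)) (linf0 (tact_linear _)).
  + by rewrite !(linfD (rb _)) (linfD (tact_linear _)) hu hv.
  elim/tensor_ind: y => [|u v hu hv|b2 d2].
  + by rewrite (linf0 (tact_linear _)) !(linf0 (lb _)) (linf0 (tact_linear _)).
  + by rewrite (linfD (tact_linear _)) !(linfD (lb _)) (linfD (tact_linear _)) hu hv.
  by rewrite tact_pure !bext_pure tactA mulrCA.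
Qed.

End Extend.

End BaseLinear.

(** * [D] as a square-zero ideal of [B (x) D] *)

Section SquareZero.
Variables (K : fieldType) (D : lmodType K) (A : comAlgType K).
Variables (eps : {lrmorphism A -> K^o}) (B : extension eps).

Local Notation I := (@mapI K D A eps B).
Local Notation P := (@Defs.mapP K D A eps B).
Local Notation E := (@mapE K D A eps B).

Lemma ext_p_linear : linear (ext_p B).
Proof. exact: linearP. Qed.

Lemma ext_eps_scalar : scalar (ext_eps B).
Proof. exact: linearP. Qed.

Lemma mapP_linear : linear P.
Proof. exact/tmap_linear/ext_p_linear. Qed.

Lemma mapE_linear : linear E.
Proof. exact/taug_linear/ext_eps_scalar. Qed.

Lemma mapI_linear : linear I.
Proof. exact: (tpure_bilin B D).1. Qed.

Lemma mapE_mapP x : E x = taug eps (P x).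
Proof.
have le : scalar eps by exact: linearP.
move: x; apply: tensor_ext => [||b d].
- exact: mapE_linear.
- by move=> k x y; rewrite mapP_linear (taug_linear le).
- rewrite /mapE /Defs.mapP tmap_pure ?taug_pure //; first exact: ext_eps_scalar.
  exact: ext_p_linear.
Qed.

Lemma mapP_act b x : P (tact b x) = tact (ext_p B b) (P x).
Proof. exact: tmap_act. Qed.

Lemma mapE_pure b d : E (b #t d) = eps (ext_p B b) *: d.
Proof. exact/taug_pure/ext_eps_scalar. Qed.

Lemma mapE_act b x : E (tact b x) = eps (ext_p B b) *: E x.
Proof.
elim/tensor_ind: x => [|x y hx hy|b' d].
- by rewrite (linf0 (tact_linear _)) (linf0 mapE_linear) scaler0.
- by rewrite (linfD (tact_linear _)) !(linfD mapE_linear) scalerDr hx hy.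
- by rewrite tact_pure !mapE_pure !rmorphM scalerA.
Qed.

Lemma ext_pi k : ext_p B (ext_i B k) = 0.
Proof. by apply/ext_exact; exists k. Qed.

Lemma mapP_mapI l : P (I l) = 0.
Proof.
rewrite /Defs.mapP tmap_pure ?ext_pi; last exact: ext_p_linear.
exact: (linf0 ((tpure_bilin A D).2 l)).
Qed.

Lemma mapI_act b l : tact b (I l) = I (eps (ext_p B b) *: l).
Proof.
rewrite /mapI tact_pure ext_module mulr1.
rewrite (linfZ ((tpure_bilin B D).1 _)) -(linfZ ((tpure_bilin B D).2 _)).
by rewrite -linearZ /= [_ *: _]mulr1.
Qed.

(** This lets [B]-bilinearity reduce products with elements of I(D) to products
    in [D]. *)
Lemma act_exti x : tact (ext_i B 1) x = I (E x).
Proof.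
elim/tensor_ind: x => [|x y hx hy|b d].
- by rewrite (linf0 (tact_linear _)) (linf0 mapE_linear) (linf0 mapI_linear).
- by rewrite (linfD (tact_linear _)) (linfD mapE_linear) (linfD mapI_linear) hx hy.
- by rewrite tact_pure mulrC -tact_pure mapI_act mapE_pure.
Qed.

Lemma mapI_ext l : I l = tact (ext_i B 1) (1 #t l).
Proof. by rewrite tact_pure mulr1. Qed.

(** A section of the projection splits off K, giving a functional on [B] that
    inverts the inclusion of K. *)
Lemma ext_retraction (q : A -> B) : linear q -> cancel q (ext_p B) ->
  exists r : B -> K, [/\ scalar r, r (ext_i B 1) = 1 &
    forall b, b = q (ext_p B b) + ext_i B (r b)].
Proof.
move=> lq qK.
have /choice [r rP] b : exists k : K^o, b - q (ext_p B b) = ext_i B k.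
  by apply/ext_exact; rewrite raddfB /= qK subrr.
have e b : b = q (ext_p B b) + ext_i B (r b) by rewrite -rP subrKC.
exists r; split=> //.
- move=> k b b'; apply: (@ext_i_inj _ _ _ B); rewrite -rP.
  rewrite [ext_i B _]linearP /= -!rP linearP lq scalerBr opprD.
  exact: addrACA.
- by apply: (@ext_i_inj _ _ _ B); rewrite -rP ext_pi (linf0 lq) subr0.
Qed.

Lemma mapI_retraction (q : A -> B) : linear q -> cancel q (ext_p B) ->
  exists J : B *t D -> D, [/\ linear J, cancel I J &
    forall x, P x = 0 -> x = I (J x)].
Proof.
move=> lq qK; have [r [lr r1 e]] := ext_retraction lq qK.
have lJ := taug_linear lr (D := D).
exists (taug r); split=> [//|l|].
  by rewrite taug_pure // r1 scale1r.
(* [B (x) D] is the direct sum of a copy of [A (x) D] and of I(D). *)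
have split x : x = tmap q (P x) + I (taug r x).
  elim/tensor_ind: x => [|x y hx hy|b d].
  - by rewrite (linf0 mapP_linear) (linf0 (tmap_linear lq)) (linf0 lJ)
      (linf0 mapI_linear) addr0.
  - rewrite (linfD mapP_linear) (linfD (tmap_linear lq)) (linfD lJ).
    rewrite (linfD mapI_linear).
    by rewrite addrACA -hx -hy.
  - rewrite /Defs.mapP tmap_pure ?tmap_pure ?taug_pure //; last exact: ext_p_linear.
    rewrite /mapI (linfZ ((tpure_bilin B D).1 _)) -(linfZ ((tpure_bilin B D).2 _)).
    rewrite -tpureDl -linearZ /= [_ *: (1 : K^o)]mulr1; congr (_ #t _); exact: e.
by move=> x Px; rewrite {1}[x]split Px (linf0 (tmap_linear lq)) add0r.
Qed.

(** The augmentation ideal of [B] annihilates I(D), so [F] does not see the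
    difference between [b (x) d] and [1 (x) eps(b) d].  This replaces the passage
    to the quotient of [B (x) D] by the kernel of E. *)
Lemma alin_ker_aug F : alin F -> (forall x, exists l, F x = I l) ->
  forall x, F x = F (1 #t E x).
Proof.
move=> hF imI; have lF := alin_linear hF.
have FZ b x : F (tact b x) = tact b (F x).
  by have := hF b x 0; rewrite addr0 (linf0 lF) addr0.
apply: tensor_ext => [//|k x y|b d].
  by rewrite mapE_linear (tpure_bilin B D).1 lF.
have -> : b #t d = tact b (1 #t d) by rewrite tact_pure mulr1.
rewrite mapE_act mapE_pure !rmorph1 scale1r FZ.
rewrite (linfZ ((tpure_bilin B D).1 _)) (linfZ lF).
by have [l ->] := imI (1 #t d); rewrite mapI_act (linfZ (@mapI_linear)).
Qed.

End SquareZero.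

(** * Lifting the products of a deformation to an extension of its base *)

Section Lifts.
Variables (K : fieldType) (D : lmodType K) (dD : dialgebra D) (A : comAlgType K).
Variables (eps : {lrmorphism A -> K^o}) (lam : deformation dD eps).
Variable (B : extension eps).

Local Notation I := (@mapI K D A eps B).
Local Notation P := (@Defs.mapP K D A eps B).
Local Notation E := (@mapE K D A eps B).
Implicit Types br : dash -> B *t D -> B *t D -> B *t D.

Lemma lift_aug br : (forall s x y, P (br s x y) = lam s (P x) (P y)) ->
  forall s x y, E (br s x y) = dD s (E x) (E y).
Proof. by move=> h s x y; rewrite !mapE_mapP h defm_aug. Qed.

Lemma abilin_ideal_l br : (forall s, abilin (br s)) ->
  (forall s x y, E (br s x y) = dD s (E x) (E y)) ->
  forall s l x, br s (I l) x = I (dD s l (E x)).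
Proof.
move=> hb hE s l x.
have := (hb s).1 (ext_i B 1) (1 #t l) 0 x.
rewrite addr0 -mapI_ext (linf0 ((abilin_bilin (hb s)).2 x)) addr0 => ->.
by rewrite act_exti hE mapE_pure !rmorph1 scale1r.
Qed.

Lemma abilin_ideal_r br : (forall s, abilin (br s)) ->
  (forall s x y, E (br s x y) = dD s (E x) (E y)) ->
  forall s x l, br s x (I l) = I (dD s (E x) l).
Proof.
move=> hb hE s x l.
have := (hb s).2 (ext_i B 1) x (1 #t l) 0.
rewrite addr0 -mapI_ext (linf0 ((abilin_bilin (hb s)).1 x)) addr0 => ->.
by rewrite act_exti hE mapE_pure !rmorph1 scale1r.
Qed.

(** Since I(l) is a [B]-multiple of [1 (x) l], [B]-bilinearity and compatibility
    with P determine the products with elements of I(D). *)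
Lemma lifted_opsP br : lifted_ops lam br <->
  (forall s, abilin (br s)) /\ (forall s x y, P (br s x y) = lam s (P x) (P y)).
Proof.
split=> [[]//|[hb hP]]; split=> // s l x.
exact: abilin_ideal_l hb (lift_aug hP) s l x.
Qed.

Lemma lifted_bilin br s : lifted_ops lam br -> bilin (br s).
Proof. by case=> hb _ _; exact: abilin_bilin. Qed.

Lemma lifted_aug br : lifted_ops lam br ->
  forall s x y, E (br s x y) = dD s (E x) (E y).
Proof. by case=> _ hP _; exact: lift_aug. Qed.

Lemma lifted_ideal_l br : lifted_ops lam br ->
  forall s l x, br s (I l) x = I (dD s l (E x)).
Proof. by case. Qed.

Lemma lifted_ideal_r br : lifted_ops lam br ->
  forall s x l, br s x (I l) = I (dD s (E x) l).
Proof. by move=> h; apply: abilin_ideal_r (lifted_aug h); case: h. Qed.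

Lemma mapP_mul_pure br : (forall s, abilin (br s)) ->
  (forall s d e, P (br s (1 #t d) (1 #t e)) = lam s (1 #t d) (1 #t e)) ->
  forall s x y, P (br s x y) = lam s (P x) (P y).
Proof.
move=> hb h s; have [lb rb] := abilin_bilin (hb s).
have [ll rl] := dprod_bilin lam s.
have lP := @mapP_linear K D A eps B.
apply: tensor_ext2.
- split=> [x k y y'|y k x x'] /=; first by rewrite (lb x) lP.
  by rewrite (rb y) lP.
- split=> [x k y y'|y k x x'] /=; first by rewrite lP (ll _).
  by rewrite lP (rl _).
move=> a d b e; rewrite (abilin_pure _ _ _ _ (hb s)) mapP_act h.
have lp := @ext_p_linear K A eps B.
rewrite /Defs.mapP !tmap_pure // rmorphM.
by rewrite (abilin_pure _ _ _ _ (defm_abilin lam s)).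
Qed.

(** On [D x D] take the products of [lam], moved to [B (x) D] by a linear section
    of the projection, and extend them [B]-bilinearly. *)
Lemma lifted_ops_exist (q : A -> B) : linear q -> cancel q (ext_p B) ->
  exists br, lifted_ops lam br.
Proof.
move=> lq qK; pose m s d e := tmap q (lam s (1 #t d) (1 #t e)) : B *t D.
have mb s : bilin (m s).
  have [ll rl] := dprod_bilin lam s.
  by split=> [d k e e'|e k d d']; rewrite /m (tpure_bilin A D).1
    ?(ll _) ?(rl _) (tmap_linear lq).
exists (fun s => bext (m s)); apply/lifted_opsP; split=> [s|].
  exact: bext_abilin.
apply: mapP_mul_pure => [s|s d e]; first exact: bext_abilin.
rewrite bext_pure // mulr1 tact1 /m.
have lp := @ext_p_linear K A eps B.
elim/tensor_ind: (lam _ _ _) => [|x y hx hy|a d'].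
- by rewrite (linf0 (tmap_linear lq)) (linf0 (@mapP_linear _ _ _ _ _)).
- by rewrite (linfD (tmap_linear lq)) (linfD (@mapP_linear _ _ _ _ _)) hx hy.
- by rewrite /Defs.mapP !tmap_pure // qK.
Qed.
End Lifts.

(** * The obstruction cocycle *)

Lemma pentagon_cancel (V : zmodType) (u1 u2 u3 u4 u5 : V) :
  u1 - u2 - (u3 - u4) + (u2 - u5) - (u1 - u3) + (u5 - u4) = 0.
Proof.
rewrite (addrAC _ _ (u2 - u5)) (subrKA u2) !opprB -(addrA (u1 - u5)) (subrKA u3).
by rewrite (addrAC _ _ (u5 - u4)) (subrKA u5) (subrKA u4) subrr.
Qed.

Lemma twist_rearrange (V : zmodType) (u1 u2 p q r s : V) :
  u1 + p + q - (u2 + r + s) = u1 - u2 + (q - r + p - s).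
Proof.
rewrite -(addrA u1) -(addrA u2) opprD addrACA [p + q]addrC.
by rewrite opprD (addrACA q) !addrA.
Qed.

Section AssociatorCochain.
Variables (K : fieldType) (D : lmodType K) (dD : dialgebra D) (A : comAlgType K).
Variables (eps : {lrmorphism A -> K^o}) (lam : deformation dD eps).
Variable (B : extension eps).

Local Notation I := (@mapI K D A eps B).
Local Notation P := (@Defs.mapP K D A eps B).
Local Notation E := (@mapE K D A eps B).
Implicit Types br : dash -> B *t D -> B *t D -> B *t D.

Let IL := @mapI_linear K D A eps B.
Let PL := @mapP_linear K D A eps B.
Let EL := @mapE_linear K D A eps B.

Lemma mapP_assoc br : lifted_ops lam br ->
  forall (y : Y 3) x1 x2 x3, P (assoc br (val y) x1 x2 x3) = 0.
Proof.
move=> [_ hP _] y x1 x2 x3; rewrite /assoc (linfB PL) !hP.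
exact: (dialgebra_assocP lam).1 (dprodP lam) y _ _ _.
Qed.

Definition induced_cochain br (c : CY D 3) : Prop :=
  forall (y : Y 3) x1 x2 x3,
    I (c y (args3 (E x1) (E x2) (E x3))) = assoc br (val y) x1 x2 x3.

Lemma induced_cochainP br c : obstruction_cochain br c <-> induced_cochain br c.
Proof.
split=> [h [t ht] x1 x2 x3|h x1 x2 x3]; last first.
  by split; rewrite -/(args3 _ _ _) h.
have [h1 h2 h3 h4 h5] := h x1 x2 x3.
have e := eqP ht; move: t e ht.
by apply: tree_ind3 => ht; rewrite (bool_irrelevance ht (eqxx 3)).
Qed.

Section Retraction.
Variable J : B *t D -> D.
Hypotheses (JL : linear J) (IK : cancel I J).
Hypothesis kerP : forall x, P x = 0 -> x = I (J x).

Lemma induced_cochain_exists br : lifted_ops lam br ->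
  exists c, induced_cochain br c.
Proof.
move=> hbr; have [hb _ _] := hbr.
pose g t a b c := J (assoc br t (1 #t a) (1 #t b) (1 #t c)).
have pl := (tpure_bilin B D).1 1.
have g1 t b c : linear (fun a => g t a b c).
  have [al _ _] := assoc_alin t hb.
  by move=> k x y; rewrite /g pl (alin_linear (al _ _)) JL.
have g2 t a c : linear (fun b => g t a b c).
  have [_ al _] := assoc_alin t hb.
  by move=> k x y; rewrite /g pl (alin_linear (al _ _)) JL.
have g3 t a b : linear (g t a b).
  have [_ _ al] := assoc_alin t hb.
  by move=> k x y; rewrite /g pl (alin_linear (al _ _)) JL.
have gc : is_cochain (fun (y : Y 3) (a : 'I_3 -> D) =>
    g (val y) (a ord0) (a (lift ord0 ord0)) (a ord_max)).
  by apply/asboolP => y; exact: trilin_multilinear.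
exists (Cochain gc) => y x1 x2 x3.
have im z1 z2 z3 : exists l, assoc br (val y) z1 z2 z3 = I l.
  by eexists; apply/kerP/mapP_assoc.
have [a1 a2 a3] := assoc_alin (val y) hb.
rewrite (alin_ker_aug (a1 _ _)) // (alin_ker_aug (a2 _ _)) //.
rewrite (alin_ker_aug (a3 _ _)) //.
exact/esym/kerP/mapP_assoc.
Qed.

(** After applying I, the outer two terms of the coboundary become products in
    [B (x) D] and the inner three become associators of products, so everything
    is a sum of bracketings of four elements of [B (x) D]. *)
Lemma induced_cocycle br c : lifted_ops lam br -> induced_cochain br c ->
  is_cocycle dD c.
Proof.
move=> hbr hc; apply/eqP/val_inj/funext => y; apply/funext => a.
rewrite (args4E a); set a1 := a _; set a2 := a _; set a3 := a _; set a4 := a _.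
transitivity (delta dD c y (args4 a1 a2 a3 a4)); first by [].
apply: (can_inj IK); rewrite (linf0 IL) delta3E.
have E1 d : d = E (1 #t d) by rewrite mapE_pure !rmorph1 scale1r.
rewrite (E1 a1) (E1 a2) (E1 a3) (E1 a4).
(* Only the E-images of the chosen representatives matter from here on. *)
move: (1 #t a1) (1 #t a2) (1 #t a3) (1 #t a4) => x1 x2 x3 x4.
have hE := lifted_aug hbr.
rewrite (linfD IL) (linfB IL) (linfD IL) (linfB IL).
rewrite -(lifted_ideal_r hbr) -(lifted_ideal_l hbr) -!hE !hc.
have bl s x := (lifted_bilin s hbr).1 x.
have br' s x := (lifted_bilin s hbr).2 x.
rewrite /assoc (linfB (bl _ _)) (linfB (br' _ _)).
have [[e1 e2 e3] [e4 e5 e6] [e7 e8 e9] [e10 e11 e12] [e13 e14 e15]] :=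
  circ_faces y.
(* Orient the equations so that the operations of each bracketing get one name. *)
rewrite -e1 e2 e3 -e4 e5 e6 e7 -e8 e9 e10 e11 -e12 e13 e14 -e15.
exact: pentagon_cancel.
Qed.

(** The difference of two lifts is [B]-bilinear with values in the kernel of P,
    so it factors through E in both arguments. *)
Lemma lifts_differ br br' : lifted_ops lam br -> lifted_ops lam br' ->
  exists psi : CY D 2, forall s x y,
    br s x y = br' s x y + I (psi (tree2 s) (args2 (E x) (E y))).
Proof.
move=> hbr hbr'; pose m s x y := br s x y - br' s x y.
have [hb hP _] := hbr; have [hb' hP' _] := hbr'.
have hm s : abilin (m s).
  split=> [b x x' y|b x y y'].
    by rewrite /m (hb s).1 (hb' s).1 tactB_rearrange.
  by rewrite /m (hb s).2 (hb' s).2 tactB_rearrange.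
have Pm s x y : P (m s x y) = 0 by rewrite (linfB PL) hP hP' subrr.
have im s x y : exists l, m s x y = I l by eexists; exact/kerP/Pm.
have mE s x y : m s x y = m s (1 #t E x) (1 #t E y).
  have al : alin (fun x => m s x y) by move=> b u v; exact: (hm s).1.
  rewrite (alin_ker_aug al) //; apply: alin_ker_aug => // b u v.
  exact: (hm s).2.
pose g s a b := J (m s (1 #t a) (1 #t b)).
have gb s : bilin (g s).
  have [lm rm] := abilin_bilin (hm s); have pl := (tpure_bilin B D).1 1.
  by split=> [a k b b'|b k a a']; rewrite /g pl ?(lm _) ?(rm _) JL.
have gc : is_cochain (fun (y : Y 2) (a : 'I_2 -> D) =>
    g (circ 0 (val y)) (a ord0) (a ord_max)).
  by apply/asboolP => y; exact: bilin_multilinear.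
exists (Cochain gc) => s x y.
transitivity (br' s x y + m s x y); first by rewrite addrC subrK.
congr (_ + _); rewrite mE (kerP (Pm _ _ _)) /= /g.
by case: s.
Qed.

End Retraction.

(** There is no term quadratic in [psi]: every lift multiplies I(l) and [x] as
    [D] multiplies l and E(x), so the correction does not enter there.  The
    linear terms are those of the coboundary. *)
Lemma assoc_twist br br' (psi : CY D 2) :
  lifted_ops lam br -> lifted_ops lam br' ->
  (forall s x y, br s x y = br' s x y + I (psi (tree2 s) (args2 (E x) (E y)))) ->
  forall (y : Y 3) x1 x2 x3,
    assoc br (val y) x1 x2 x3 = assoc br' (val y) x1 x2 x3
      + I (delta dD psi y (args3 (E x1) (E x2) (E x3))).
Proof.
move=> hbr hbr' h y x1 x2 x3.
have hE := lifted_aug hbr'.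
have lb s x := (lifted_bilin s hbr).1 x.
have rb s x := (lifted_bilin s hbr).2 x.
have [f0 f1 f2 f3] := face3E y.
rewrite delta2E f0 f1 f2 f3 /assoc [br _ x2 x3]h [br _ x1 x2]h.
rewrite (linfD (lb _ _)) (linfD (rb _ _)) (lifted_ideal_l hbr) (lifted_ideal_r hbr).
rewrite !h !hE [in RHS](linfB IL) [in RHS](linfD IL) [in RHS](linfB IL).
exact: twist_rearrange.
Qed.

Lemma twist_lifted br (psi : CY D 2) : lifted_ops lam br ->
  lifted_ops lam (fun s x y =>
    br s x y - I (psi (tree2 s) (args2 (E x) (E y)))).
Proof.
move=> [hb hP _]; apply/lifted_opsP; split=> [s|s x y]; last first.
  by rewrite (linfB PL) hP mapP_mapI subr0.
have [pl pr] := multilinear_bilin psi (tree2 s).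
split=> [b x x' y|b x y y'].
- rewrite (hb s).1 (linfD EL) mapE_act (pr _) IL.
  rewrite (linfB (tact_linear _)) mapI_act (linfZ IL) opprD; exact: addrACA.
- rewrite (hb s).2 (linfD EL) mapE_act (pl _) IL.
  rewrite (linfB (tact_linear _)) mapI_act (linfZ IL) opprD; exact: addrACA.
Qed.

End AssociatorCochain.

(** * Dependence on the Harrison class only, and the obstruction *)

Section Transport.
Variables (K : fieldType) (A : comAlgType K) (eps : {lrmorphism A -> K^o}).

Lemma ext_mul_i (B : extension eps) j k : ext_i B j * ext_i B k = 0.
Proof. by rewrite ext_module ext_pi rmorph0 mul0r raddf0. Qed.

(** Write the two extensions as A + K with products twisted by cocycles [f] and
    [f'].  If [f - f'] is the coboundary of [g], then (a, k) |-> (a, k + g(a)) is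
    multiplicative.  It is unital because the image of 1 is an idempotent of the
    form 1 + i(k) with i(k) of square zero. *)
Lemma ext_hom (c : HHarr2 eps) (B B' : extension eps) :
  ext_corresponds B c -> ext_corresponds B' c ->
  exists phi : {lrmorphism B -> B'}, forall b, ext_p B' (phi b) = ext_p B b.
Proof.
move=> [q [f [lq qK qM fc]]] [q' [f' [lq' qK' qM' fc']]].
have [r [lr _ rE]] := ext_retraction lq qK.
have [g lg fg] : exists2 g : A -> K^o, linear g &
    forall a b, f a b - f' a b = eps a * g b - g (a * b) + g a * eps b.
  have : HHarr2cl f == HHarr2cl f' by rewrite fc fc'.
  by rewrite /HHarr2cl -Quotient.idealrBE => /asboolP.
pose h b := r b + g (ext_p B b) : K^o.
pose phi b := q' (ext_p B b) + ext_i B' (h b).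
have phiK b : ext_p B' (phi b) = ext_p B b by rewrite raddfD /= qK' ext_pi addr0.
have lphi : linear phi.
  have lh : linear h.
    move=> k x y; rewrite /h (@ext_p_linear _ _ _ B) lr lg scalerDr.
    exact: addrACA.
  move=> k x y; rewrite /phi (@ext_p_linear _ _ _ B) lq' lh linearP scalerDr.
  exact: addrACA.
have rM x y : r (x * y) =
    f (ext_p B x) (ext_p B y) + eps (ext_p B x) * r y + eps (ext_p B y) * r x.
  apply: (@ext_i_inj _ _ _ B); apply: (addrI (q (ext_p B (x * y)))).
  rewrite -rE {1}[x]rE {1}[y]rE rmorphM mulrDl !mulrDr ext_mul_i addr0 qM.
  by rewrite [ext_i B _ * _]mulrC !ext_module !qK !raddfD /= !addrA.
have phiM : {morph phi : x y / x * y}.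
  move=> x y; rewrite /phi mulrDl !mulrDr ext_mul_i addr0 qM' rmorphM.
  rewrite [ext_i B' _ * _]mulrC !ext_module !qK' -!addrA -!raddfD /=.
  congr (_ + ext_i B' _); rewrite /h rM rmorphM.
  have := fg (ext_p B x) (ext_p B y) => /eqP; rewrite subr_eq => /eqP ->.
  by rewrite !mulrDr; ring.
have phi1 : phi 1 = 1.
  have /ext_exact [k e] : ext_p B' (phi 1 - 1) = 0.
    by rewrite raddfB /= phiK !rmorph1 subrr.
  have u : phi 1 = 1 + ext_i B' k by rewrite -e subrKC.
  have := phiM 1 1; rewrite mulr1 u mulrDl !mulrDr ext_mul_i !mulr1 mul1r addr0.
  rewrite -addrA => /addrI/eqP; rewrite eq_sym -subr_eq0 addrK => /eqP ->.
  by rewrite addr0.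
pose L := GRing.isLinear.Build K B B' *:%R phi lphi.
pose M := GRing.isMonoidMorphism.Build B B' phi (phi1, phiM).
pose F : {lrmorphism B -> B'} := HB.pack phi L M.
by exists F.
Qed.

Variables (D : lmodType K) (dD : dialgebra D) (lam : deformation dD eps).

Lemma deformation_ext (C : comAlgType K) (e : {lrmorphism C -> K^o})
    (m m' : deformation dD e) : (forall s x y, m s x y = m' s x y) -> m = m'.
Proof.
case: m m' => [[m mb mP] ma me] [[m' mb' mP'] ma' me'] /= h.
have E : m = m' by apply/funext => s; apply/funext => x; apply/funext => y.
case: _ / E mb' mP' ma' me' => mb' mP' ma' me'.
rewrite (Prop_irrelevance mb mb') (Prop_irrelevance mP mP') in ma me *.
by congr Deformation; exact: Prop_irrelevance.
Qed.

(** P is onto, so a deformation with base [A] is determined by its products of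
    elements in the image of P, where the push-out is given by P. *)
Lemma pushout_lamP (B : extension eps) (mu : deformation dD (ext_eps B)) :
  pushout (eps := ext_eps B) (fun b => erefl) mu = lam <-> lifted_ops lam mu.
Proof.
have pE s x y : pushout (eps := ext_eps B) (fun b => erefl) mu s
    (Defs.mapP x) (Defs.mapP y) = Defs.mapP (mu s x y).
  have := pushout_prodE (ext_p B) mu s 1 1 x y.
  by rewrite mulr1 !tact1.
split=> [e|/lifted_opsP [_ h]].
  apply/lifted_opsP; split=> [s|s x y]; first exact: defm_abilin.
  by rewrite -pE e.
have surj (z : A *t D) : exists x : B *t D, Defs.mapP x = z.
  elim/tensor_ind: z => [|_ _ [x <-] [y <-]|a d].
  - exists 0; exact/linf0/mapP_linear.
  - by exists (x + y); rewrite (linfD (@mapP_linear _ _ _ _ _)).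
  - have [b <-] := ext_p_surj B a; exists (b #t d).
    exact/tmap_pure/ext_p_linear.
apply: deformation_ext => s x' y'; have [x <-] := surj x'; have [y <-] := surj y'.
by rewrite pE h.
Qed.

(** The push-out along [phi] again lifts [lam], by functoriality; it suffices to
    compare products of elements of [D]. *)
Lemma extendable_hom (B B' : extension eps) (phi : {lrmorphism B -> B'}) :
  (forall b, ext_p B' (phi b) = ext_p B b) ->
  (exists mu : deformation dD (ext_eps B), lifted_ops lam mu) ->
  exists mu' : deformation dD (ext_eps B'), lifted_ops lam mu'.
Proof.
move=> phiK [mu hmu]; have [_ hP _] := hmu.
have pe b : ext_eps B' (phi b) = ext_eps B b by congr (eps _).
have lphi : linear phi by exact: linearP.
exists (pushout pe mu); apply/lifted_opsP; split=> [s|].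
  exact: defm_abilin.
apply: mapP_mul_pure => [s|s d e]; first exact: defm_abilin.
rewrite [pushout _ _ _ _ _](pushout_prod_pure phi mu) mulr1 tact1.
have -> : lam s (1 #t d) (1 #t e) = Defs.mapP (mu s (1 #t d) (1 #t e)).
  by rewrite hP /Defs.mapP !tmap_pure ?rmorph1 //; exact: ext_p_linear.
elim/tensor_ind: (mu _ _ _) => [|x y hx hy|b z].
- by rewrite (linf0 (tmap_linear lphi)) !(linf0 (@mapP_linear _ _ _ _ _)).
- by rewrite (linfD (tmap_linear lphi)) !(linfD (@mapP_linear _ _ _ _ _)) hx hy.
- by rewrite /Defs.mapP !tmap_pure ?phiK //; exact: ext_p_linear.
Qed.

Lemma extendable_class (c : HHarr2 eps) (B B' : extension eps) :
  ext_corresponds B c -> ext_corresponds B' c ->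
  (exists mu : deformation dD (ext_eps B), lifted_ops lam mu) ->
  exists mu' : deformation dD (ext_eps B'), lifted_ops lam mu'.
Proof. by move=> h h'; have [phi /extendable_hom] := ext_hom h h'; apply. Qed.

Lemma deformation_of_lift (B : extension eps)
    (br : dash -> B *t D -> B *t D -> B *t D) :
  lifted_ops lam br -> (forall (y : Y 3) x1 x2 x3, assoc br (val y) x1 x2 x3 = 0) ->
  exists mu : deformation dD (ext_eps B), lifted_ops lam mu.
Proof.
move=> hbr h; have [hb _ _] := hbr.
pose m := Dialgebra (fun s => lifted_bilin s hbr) ((dialgebra_assocP br).2 h).
by exists (@Deformation K D dD B (ext_eps B) m hb (lifted_aug hbr)).
Qed.

(** Whatever extension and lift the class [h] was computed from, its cochain is
    the failure of associativity of that lift, and the lifts of an extendable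
    [lam] are exactly the twists of an associative one. *)
Lemma extendable_obstruction (c : HHarr2 eps) (B : extension eps) h :
  ext_corresponds B c -> is_obstruction lam c h ->
  ((exists mu : deformation dD (ext_eps B), lifted_ops lam mu) <-> h = 0).
Proof.
move=> hB [B' [br [o [hB' hbr /induced_cochainP ho ->]]]].
have [q [_ [lq qK _ _]]] := hB'.
have [J [JL IK kerP]] := mapI_retraction D lq qK.
have IL := @mapI_linear K D A eps B'.
have E1 d : d = mapE (1 #t d : B' *t D) by rewrite mapE_pure !rmorph1 scale1r.
split=> [/(extendable_class hB hB') [mu hmu]|/eqP].
  have [psi hpsi] := lifts_differ JL kerP hbr hmu.
  apply/eqP; rewrite HYcl_eq0; apply/asboolP; exists psi.
  apply/val_inj/funext => y; apply/funext => a.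
  rewrite (args3E a) (E1 (a ord0)) (E1 (a (lift _ _))) (E1 (a ord_max)).
  apply: (can_inj IK); rewrite ho (assoc_twist hbr hmu hpsi).
  by rewrite ((dialgebra_assocP mu).1 (dprodP mu)) add0r.
rewrite HYcl_eq0 => /asboolP [psi opsi].
have hbr' := twist_lifted psi hbr.
apply: (extendable_class hB' hB); apply: (deformation_of_lift hbr') => y x1 x2 x3.
apply: (addIr (mapI B' (delta dD psi y (args3 (mapE x1) (mapE x2) (mapE x3))))).
rewrite -(assoc_twist hbr hbr') => [|s x x']; last by rewrite subrK.
by rewrite add0r -ho opsi.
Qed.

Lemma obstruction_exists (c : HHarr2 eps) (B : extension eps) :
  ext_corresponds B c -> exists h, is_obstruction lam c h.
Proof.
move=> hB; have [q [_ [lq qK _ _]]] := hB.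
have [J [JL IK kerP]] := mapI_retraction D lq qK.
have [br hbr] := lifted_ops_exist lam lq qK.
have [o ho] := induced_cochain_exists JL kerP hbr.
exists (HYcl (Cocycle (induced_cocycle IK hbr ho))), B, br.
by exists (Cocycle (induced_cocycle IK hbr ho)); split=> //; apply/induced_cochainP.
Qed.

End Transport.

Theorem proposition6p1 (K : fieldType) (hK : [pchar K] =i pred0)
  (D : lmodType K) (dD : dialgebra D)
  (A : comAlgType K) (hfin : finite_dim A) (hloc : local_ring A)
  (eps : {lrmorphism A -> K^o}) (lam : deformation dD eps)
  (f : HHarr2 eps) (B : extension eps) (hB : ext_corresponds B f) :
  (exists mu : deformation dD (ext_eps B),
     pushout (eps := ext_eps B) (fun b => erefl) mu = lam) <->
  obstruction lam f = 0.
Proof.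
have h := xgetPex 0 (obstruction_exists lam hB).
rewrite -(extendable_obstruction hB h).
by split=> -[mu /pushout_lamP hmu]; exists mu.
Qed.
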